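(* Let $B\subset\mathbb{R}^3$ be an open set, let $f=(f^4,f^5,f^6,f^7):B\to T^4$ be a smooth map, let $X=B\times T^4$ carry the flat metric and the standard $G_2$-structure $\varphi$, and let $S=\{(x,f(x))\mid x\in B\}\subset X$ be the graph of $f$. Let $$F^S_\nabla=\sqrt{-1}\sum_{i=1}^3\sum_{a=4}^7\frac{\partial f^a}{\partial x^i}\,dx^i\wedge dy^a$$ be the curvature of the real Fourier--Mukai transform of $S$. Then the following are equivalent. (1) $S$ is an associative submanifold for an appropriate orientation. (2) $\frac16(F^S_\nabla)^3+F^S_\nabla\wedge*\varphi=0$. (3) $\frac16(F^S_\nabla)^3+F^S_\nabla\wedge*\varphi=0$ and $\varphi\wedge*\big((F^S_\nabla)^2\big)=0$.
   Context: $T^4=\mathbb{R}^4/(2\pi\mathbb{Z})^4$. Coordinates on $B$ are $(x^1,x^2,x^3)$ and on $T^4$ are $(y^4,\dots,y^7)$; $X=B\times T^4$ has the flat metric $\sum(dx^i)^2+\sum(dy^a)^2$ and orientation $dx^{123}\wedge dy^{4567}$; $*$ is the Hodge star; powers of forms are wedge powers and $dx^{ij}=dx^i\wedge dx^j$, etc. Set $\omega_1=dy^{45}+dy^{67}$, $\omega_2=dy^{46}+dy^{75}$, $\omega_3=-(dy^{47}+dy^{56})$. The standard $G_2$-structure and its Hodge dual are $\varphi=dx^{123}+\sum_{i=1}^3dx^i\wedge\omega_i$ and $*\varphi=dy^{4567}+dx^{12}\wedge\omega_3+dx^{23}\wedge\omega_1+dx^{31}\wedge\omega_2$. Associative: an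 oriented 3-dimensional submanifold calibrated by $\varphi$, i.e. $\varphi$ restricts to the induced volume form. Real Fourier--Mukai transform of $S$: identifying $B\times(T^4)^*$ with $X$, the Hermitian connection $d+\sqrt{-1}\sum_{a=4}^7f^ady^a$ of the trivial complex line bundle over $X$. (The components $f^a$ are defined modulo $2\pi$, so their derivatives are well-defined functions on $B$.) *)

(* Defs.v *)
From HB Require Import structures.
From mathcomp Require Import all_boot all_order all_algebra.
From mathcomp Require Import generic_quotient.
From mathcomp Require Import all_classical all_reals all_analysis.
From mathcomp Require Import complex.

Set Implicit Arguments.
Unset Strict Implicit.
Unset Printing Implicit Defensive.

Import Order.TTheory GRing.Theory Num.Theory.
Import numFieldNormedType.Exports.

Local Open Scope classical_set_scope.
Local Open Scope ring_scope.
Local Open Scope quotient_scope.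

(* An element of the exterior algebra of (R^7)^* is given by its coefficients
   on the basis e_I = e_{i1} /\ ... /\ e_{ik}, for I = {i1 < ... < ik}.  The
   indices 0..6 of 'I_7 stand for the coordinates x^1, x^2, x^3, y^4, ..., y^7
   in this order. *)
Section Exterior.
Variable K : comNzRingType.

Definition ext := {ffun {set 'I_7} -> K}.

(* e_I /\ e_J = shuffle_sign I J e_{I u J} for disjoint I and J: the exponent
   counts the inversions of the concatenation of I and J. *)
Definition shuffle_sign (I J : {set 'I_7}) : K :=
  (-1) ^+ #|[pred ij : 'I_7 * 'I_7 |
              [&& ij.1 \in I, ij.2 \in J & (ij.2 < ij.1)%N]]|.

Definition wedge (u v : ext) : ext :=
  [ffun I : {set 'I_7} => \sum_(J : {set 'I_7} | J \subset I)
     shuffle_sign J (I :\: J) * u J * v (I :\: J)].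

Definition ext1 : ext := [ffun I : {set 'I_7} => (I == finset.set0)%:R].

Definition wedge_exp (u : ext) (n : nat) : ext := iterop n wedge u ext1.

(* The Hodge star of the metric for which e_0, ..., e_6 is an oriented
   orthonormal coframe: *e_I = shuffle_sign I I^c e_{I^c}, so that
   e_I /\ *e_I is the volume form.  It is extended K-linearly, in particular
   complex-linearly on complex-valued forms. *)
Definition hodge (u : ext) : ext :=
  [ffun I : {set 'I_7} => shuffle_sign (~: I) I * u (~: I)].

(* The value of the degree k part of u on the rows of V: e_I is evaluated as
   the minor of V with columns in I, taken in increasing order. *)
Definition ext_eval (k : nat) (u : ext) (V : 'M[K]_(k, 7)) : K :=
  \sum_(I : {set 'I_7} | #|I| == k)
    u I * \det (\matrix_(i < k, j < k) V i (nth ord0 (enum I) j)).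

Definition covec (m : 'I_7) : ext :=
  [ffun I : {set 'I_7} => (I == [set m]%SET)%:R].

(* dx i is dx^{i+1} and dy a is dy^{a+4}. *)
Definition dx (i : 'I_3) : ext := covec (lshift 4 i).
Definition dy (a : 'I_4) : ext := covec (rshift 3 a).

Local Notation "u /\^ v" := (wedge u v) (at level 40, left associativity).
Local Notation x1 := (dx (@Ordinal 3 0 isT)).
Local Notation x2 := (dx (@Ordinal 3 1 isT)).
Local Notation x3 := (dx (@Ordinal 3 2 isT)).
Local Notation y4 := (dy (@Ordinal 4 0 isT)).
Local Notation y5 := (dy (@Ordinal 4 1 isT)).
Local Notation y6 := (dy (@Ordinal 4 2 isT)).
Local Notation y7 := (dy (@Ordinal 4 3 isT)).

Definition omega1 : ext := y4 /\^ y5 + y6 /\^ y7.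
Definition omega2 : ext := y4 /\^ y6 + y7 /\^ y5.
Definition omega3 : ext := - (y4 /\^ y7 + y5 /\^ y6).

Definition g2_phi : ext :=
  x1 /\^ x2 /\^ x3 + (x1 /\^ omega1 + x2 /\^ omega2 + x3 /\^ omega3).

End Exterior.

Section Smooth.
Variables (R : realType) (V W : normedModType R).

(* All iterated directional derivatives of order at most k exist and are
   continuous on U; for finite-dimensional V and W this is C^k on the open
   set U. *)
Fixpoint Ck_on (k : nat) (U : set V) (f : V -> W) : Prop :=
  (forall x, U x -> {for x, continuous f}) /\
  (if k is k'.+1 then
     forall v : V, (forall x, U x -> derivable f x v) /\ Ck_on k' U ('D_v f)
   else True).

Definition smooth_on (U : set V) (f : V -> W) : Prop :=
  forall k : nat, Ck_on k U f.

End Smooth.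

Section Torus.
Variable R : realType.

Definition torus_rel (y z : 'rV[R]_4) : bool :=
  `[< exists k : 'I_4 -> int,
        forall a, y ord0 a - z ord0 a = 2 * pi * (k a)%:~R >].

Lemma torus_rel_refl : reflexive torus_rel.
Proof. by move=> y; apply/asboolP; exists (fun=> 0) => a; rewrite subrr mulr0. Qed.

Lemma torus_rel_sym : symmetric torus_rel.
Proof.
have H y z : torus_rel y z -> torus_rel z y; last by move=> y z; apply/idP/idP => /H.
move=> /asboolP[k kE]; apply/asboolP; exists (fun a => - k a) => a.
by rewrite -opprB kE rmorphN mulrN.
Qed.

Lemma torus_rel_trans : transitive torus_rel.
Proof.
move=> z y w /asboolP[k kE] /asboolP[l lE]; apply/asboolP.
exists (fun a => k a + l a) => a.
by rewrite rmorphD mulrDr -kE -lE subrKA.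
Qed.

Canonical torus_equiv : equiv_rel 'rV[R]_4 :=
  EquivRel torus_rel torus_rel_refl torus_rel_sym torus_rel_trans.

Definition torus := {eq_quot torus_equiv}.

Definition torus_proj (y : 'rV[R]_4) : torus := \pi_torus y.

Definition ambient := ('rV[R]_3 * torus)%type.

(* The covering map R^7 = R^3 x R^4 -> R^3 x T^4; its local inverses are the
   charts of the target. *)
Definition ambient_proj (z : 'rV[R]_(3 + 4)) : ambient :=
  (lsubmx z, torus_proj (rsubmx z)).

End Torus.

Section TorusMaps.
Variable R : realType.
Implicit Types (B U : set 'rV[R]_3) (f : 'rV[R]_3 -> torus R).

(* g is a smooth lift of f to R^4 on a neighbourhood of x; the components of g
   are determinations near x of the components of f, which are defined
   modulo 2 pi. *)
Definition smooth_lift_at f (x : 'rV[R]_3) (g : 'rV[R]_3 -> 'rV[R]_4) : Prop :=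
  exists U, [/\ open U, U x, smooth_on U g &
                forall z, U z -> torus_proj (g z) = f z].

Definition torus_smooth_on B f : Prop :=
  forall x, B x -> exists g, smooth_lift_at f x g.

(* The partial derivative of the a-th component of f with respect to the i-th
   coordinate.  Two smooth lifts near x differ by a constant near x, so the
   value does not depend on the lift selected by xget. *)
Definition torus_partial f (a : 'I_4) (i : 'I_3) (x : 'rV[R]_3) : R :=
  'D_(delta_mx ord0 i)
    (fun z : 'rV[R]_3 => xget (fun=> 0) [set g | smooth_lift_at f x g] z ord0 a) x.

Definition torus_graph B f : set (ambient R) := [set (x, f x) | x in B].

(* The curvature of the connection d + sqrt(-1) sum_a f^a dy^a, as a section
   over B x T^4 of the bundle of complex-valued forms. *)
Definition curvature f (p : ambient R) : ext R[i] :=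
  (Complex 0 1 : R[i]) *: \sum_(i < 3) \sum_(a < 4)
    (real_complex R (torus_partial f a i p.1) : R[i]) *:
      wedge (dx R[i] i) (dy R[i] a).

End TorusMaps.

Section Associative.
Variable R : realType.
Implicit Types (B : set 'rV[R]_3) (S : set (ambient R)) (p : ambient R).

(* S is a 3-dimensional embedded submanifold: around each of its points there
   is a slice chart, that is, a diffeomorphism h (with inverse k) between open
   subsets of R^7 mapping S onto R^3 x {0}. *)
Definition submanifold3 S : Prop :=
  forall z : 'rV[R]_(3 + 4), S (ambient_proj z) ->
  exists (W W' : set 'rV[R]_(3 + 4)) (h k : 'rV[R]_(3 + 4) -> 'rV[R]_(3 + 4)),
    [/\ [/\ open W, W z & open W'],
        smooth_on W h /\ smooth_on W' k,
        (forall w, W w -> W' (h w) /\ k (h w) = w),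
        (forall w, W' w -> W (k w) /\ h (k w) = w) &
        (forall w, W w -> (S (ambient_proj w) <-> rsubmx (h w) = 0))].

(* The tangent space of S at p, as a subset of R^7: the velocities at p of the
   smooth curves in S. *)
Definition tangent S p : set 'rV[R]_(3 + 4) :=
  [set v | exists (e : R) (c : R -> 'rV[R]_(3 + 4)),
     [/\ 0 < e, smooth_on `]- e, e[%classic c,
         (forall t, - e < t < e -> S (ambient_proj (c t))),
         ambient_proj (c 0) = p & 'D_1 c 0 = v]].

Definition tangent_frame S p (V : 'M[R]_(3, 3 + 4)) : Prop :=
  (forall i, tangent S p (row i V)) /\ row_free V.

(* o p V tells whether the frame V of the tangent space at p is positive.  The
   first condition says that o p is an orientation of each tangent space, the
   second that each point has a neighbourhood on which there is a continuous
   positive frame. *)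
Definition orientation S (o : ambient R -> 'M[R]_(3, 3 + 4) -> bool) : Prop :=
  (forall p V (A : 'M[R]_3), S p -> tangent_frame S p V -> A \in unitmx ->
     o p (A *m V) = (o p V == (0 < \det A))) /\
  (forall z : 'rV[R]_(3 + 4), S (ambient_proj z) ->
     exists (W : set 'rV[R]_(3 + 4)) (E : 'rV[R]_(3 + 4) -> 'M[R]_(3, 3 + 4)),
       [/\ open W, W z, {within W `&` (S \o @ambient_proj R), continuous E} &
           forall w, W w -> S (ambient_proj w) ->
             tangent_frame S (ambient_proj w) (E w) /\
             o (ambient_proj w) (E w)]).

(* The value at p of the Riemannian volume form induced by the flat metric and
   the orientation o, on three tangent vectors (the rows of V).  For linearly
   dependent vectors the Gram determinant vanishes. *)
Definition induced_volume (o : ambient R -> 'M[R]_(3, 3 + 4) -> bool) p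
    (V : 'M[R]_(3, 3 + 4)) : R :=
  (if o p V then 1 else -1) * Num.sqrt (\det (V *m V^T)).

Definition associative_submanifold B S o : Prop :=
  [/\ S `<=` [set p | B p.1], submanifold3 S, orientation S o &
      forall p (V : 'M[R]_(3, 3 + 4)), S p -> (forall i, tangent S p (row i V)) ->
        ext_eval (g2_phi R) V = induced_volume o p V].

End Associative.

(* Main.v *)
Require Import Defs.
From HB Require Import structures.
From mathcomp Require Import all_boot all_order all_algebra.
From mathcomp Require Import generic_quotient.
From mathcomp Require Import all_classical all_reals all_analysis.
From mathcomp Require Import complex ring.

(* The tangent space of the graph at (x, f x) is spanned by the rows of M = (1 | A), where A is
   the Jacobian of f at x.  For the calibration phi there is the Harvey-Lawson identity
   [det (M M^T) = phi(M)^2 + |tau(M)|^2], where tau is the normal-bundle-valued 3-form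
   dual to *phi.  Hence the graph is associative, for the orientation making phi
   positive, iff tau(M) = 0.  The four components of tau(M) along T^4 are, up to signs and a
   factor of i, the coefficients of (1/6) F^3 + F /\ *phi.  Since tau(M) is orthogonal to
   the rows of M, its three components along B are linear combinations of these four with
   coefficients in A; up to a factor of 2 they are the coefficients of phi /\ *(F^2). *)

Set Implicit Arguments.
Unset Strict Implicit.
Unset Printing Implicit Defensive.

Import Order.TTheory GRing.Theory Num.Theory.
Import numFieldNormedType.Exports.

Local Open Scope classical_set_scope.
Local Open Scope ring_scope.

(** * Exterior algebra by computation *)

(** The form F is i times a real 2-form, so F^3 and F contribute the factors -i and i; the cubic
    equation is therefore i times a real polynomial system in the twelve entries of A. The sum of
    squares also supplies the orientation: where tau(M) vanishes, phi(M)^2 is the Gram determinant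
    of (1 | A), which is positive, so phi has no zero on tangent frames and its sign is locally
    constant, whether or not B is connected. On the analytic side the obstacle is that f lifts to
    R^4 only locally, and that the partial derivatives of f and the curves in its graph come with
    lifts of their own. Discreteness of the fibres of R^4 -> T^4 makes the derivatives of all these
    lifts agree. Smoothness is expressed by directional derivatives, so total differentiability,
    which the chain rule requires, has to be derived from the continuity of the partial
    derivatives. *)

Section Basis.
Variable K : comNzRingType.
Implicit Types (u v w : ext K) (I J : {set 'I_7}).

(* [K] carries no canonical [K]-module structure, so [*:] is not available. *)
Definition extZ (c : K) u : ext K := [ffun I => c * u I].

Lemma extZE (c : K) u I : extZ c u I = c * u I.
Proof. by rewrite ffunE. Qed.

Lemma extDE u v I : (u + v) I = u I + v I.
Proof. by rewrite ffunE. Qed.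

Lemma ext0Z u : extZ 0 u = 0.
Proof. by apply/ffunP => I; rewrite !ffunE mul0r. Qed.

Lemma extZA (c d : K) u : extZ c (extZ d u) = extZ (c * d) u.
Proof. by apply/ffunP => I; rewrite !ffunE mulrA. Qed.

Definition ext_basis I : ext K := [ffun J => (J == I)%:R].

Lemma wedgeDl u v w : wedge (u + v) w = wedge u w + wedge v w.
Proof.
apply/ffunP => I; rewrite !ffunE -big_split; apply: eq_bigr => J _ /=.
by rewrite ffunE mulrDr mulrDl.
Qed.

Lemma wedgeDr u v w : wedge w (u + v) = wedge w u + wedge w v.
Proof.
apply/ffunP => I; rewrite !ffunE -big_split; apply: eq_bigr => J _ /=.
by rewrite ffunE mulrDr.
Qed.

Lemma wedgeZl (c : K) u w : wedge (extZ c u) w = extZ c (wedge u w).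
Proof.
apply/ffunP => I; rewrite !ffunE mulr_sumr; apply: eq_bigr => J _.
by rewrite ffunE; ring.
Qed.

Lemma wedgeZr (c : K) u w : wedge u (extZ c w) = extZ c (wedge u w).
Proof.
apply/ffunP => I; rewrite !ffunE mulr_sumr; apply: eq_bigr => J _.
by rewrite ffunE; ring.
Qed.

Lemma wedge_suml (T : Type) (r : seq T) (G : T -> ext K) w :
  wedge (\sum_(t <- r) G t) w = \sum_(t <- r) wedge (G t) w.
Proof.
elim: r => [|t r IH]; last by rewrite !big_cons wedgeDl IH.
by rewrite !big_nil -[0](ext0Z 0) wedgeZl !ext0Z.
Qed.

Lemma wedge_sumr (T : Type) (r : seq T) (G : T -> ext K) w :
  wedge w (\sum_(t <- r) G t) = \sum_(t <- r) wedge w (G t).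
Proof.
elim: r => [|t r IH]; last by rewrite !big_cons wedgeDr IH.
by rewrite !big_nil -[0](ext0Z 0) wedgeZr !ext0Z.
Qed.

(** In the coefficient at [L] only the summand indexed by [I] can survive, and it does so exactly
    when [L] is the disjoint union of [I] and [J]. *)
Lemma wedge_basis I J : wedge (ext_basis I) (ext_basis J) =
  if [disjoint I & J] then extZ (shuffle_sign K I J) (ext_basis (I :|: J)) else 0.
Proof.
apply/ffunP => L; rewrite ffunE.
have zero M : M != I -> shuffle_sign K M (L :\: M) * ext_basis I M * ext_basis J (L :\: M) = 0.
  by move=> MI; rewrite /ext_basis !ffunE (negbTE MI) mulr0 mul0r.
have -> : \sum_(M : {set 'I_7} | M \subset L)
    shuffle_sign K M (L :\: M) * ext_basis I M * ext_basis J (L :\: M) =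
  ((I \subset L) && (L :\: I == J))%:R * shuffle_sign K I J.
  case: (boolP (I \subset L)) => IL; last first.
    rewrite mul0r big1 // => M ML; apply: zero.
    by apply: contra IL => /eqP <-.
  rewrite (bigD1 I) //= big1 ?addr0 => [|M /andP[_ MI]]; last exact: zero.
  rewrite /ext_basis !ffunE eqxx mulr1; case: eqP => [->|_].
    by rewrite mulr1 mul1r.
  by rewrite mulr0 mul0r.
have -> : (I \subset L) && (L :\: I == J) = [disjoint I & J] && (L == I :|: J).
  apply/andP/andP => [[IL /eqP <-]|[IJ /eqP ->]].
    split; first by rewrite disjoint_sym finset.disjoints_subset finset.setDE finset.subsetIr.
    apply/eqP/finset.setP => x; rewrite !inE.
    by case: (boolP (x \in I)) => [/(fintype.subsetP IL) ->|].
  split; first exact: finset.subsetUl.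
  rewrite finset.setDUl finset.setDv finset.set0U; apply/eqP/finset.setDidPl.
  by rewrite disjoint_sym.
case: ifP => _ /=; last by rewrite mul0r ffunE.
by rewrite !ffunE mulrC.
Qed.

Lemma hodgeD u v : hodge (u + v) = hodge u + hodge v.
Proof. by apply/ffunP => I; rewrite !ffunE mulrDr. Qed.

Lemma hodgeZ (c : K) u : hodge (extZ c u) = extZ c (hodge u).
Proof. by apply/ffunP => I; rewrite !ffunE; ring. Qed.

Lemma hodge_sum (T : Type) (r : seq T) (G : T -> ext K) :
  hodge (\sum_(t <- r) G t) = \sum_(t <- r) hodge (G t).
Proof.
elim: r => [|t r IH]; last by rewrite !big_cons hodgeD IH.
by rewrite !big_nil -[0](ext0Z 0) hodgeZ !ext0Z.
Qed.

Lemma hodge_basis I : hodge (ext_basis I) = extZ (shuffle_sign K I (~: I)) (ext_basis (~: I)).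
Proof.
apply/ffunP => J; rewrite !ffunE.
rewrite (inv_eq (@finset.setCK _)); case: eqP => [->|_]; last by rewrite !mulr0.
by rewrite finset.setCK.
Qed.

End Basis.

(** * Symbolic computation with forms *)

Section FormList.

(* A term [(s, v, I)] stands for the form [(-1)^s a_v1 ... a_vn e_I], for an environment [a]
   giving values to the variables; products of such forms are computed by [vm_compute]. *)
Definition form_list := seq (bool * seq nat * seq nat).
Implicit Types (s : seq nat) (l m : form_list).

(** Index lists stand for sets: only membership is tested, so they may be unsorted after
    concatenation, and the count is still the exponent in [shuffle_sign]. *)
Definition inversions s (t : seq nat) : nat :=
  sumn [seq sumn [seq nat_of_bool [&& i \in s, j \in t & (j < i)%N] | j <- iota 0 7]
       | i <- iota 0 7].

Definition disj s (t : seq nat) := all (fun i => ~~ ((i \in s) && (i \in t))) (iota 0 7).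
Definition same s (t : seq nat) := all (fun i => (i \in s) == (i \in t)) (iota 0 7).
Definition compl s := [seq i <- iota 0 7 | i \notin s].

Definition form_wedge l m : form_list :=
  flatten [seq [seq (t.1.1 (+) u.1.1 (+) odd (inversions t.2 u.2),
                     t.1.2 ++ u.1.2, t.2 ++ u.2)
               | u <- m & disj t.2 u.2] | t <- l].

Definition form_hodge l : form_list :=
  [seq (t.1.1 (+) odd (inversions t.2 (compl t.2)), t.1.2, compl t.2) | t <- l].

Definition form_coef l s : seq (bool * seq nat) := [seq t.1 | t <- l & same t.2 s].

Variable K : comNzRingType.
Implicit Type a : nat -> K.

Definition index_set s : {set 'I_7} := [set i : 'I_7 | val i \in s]%SET.
Definition monomial a (c : bool * seq nat) : K := (-1) ^+ c.1 * \prod_(k <- c.2) a k.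
Definition denote a l : ext K :=
  \sum_(t <- l) extZ (monomial a t.1) (ext_basis K (index_set t.2)).

Lemma all_iotaP (P : pred nat) : reflect (forall i : 'I_7, P i) (all P (iota 0 7)).
Proof.
apply: (iffP allP) => [H i|H i]; first by apply: H; rewrite mem_iota /=.
by rewrite mem_iota /= => i7; apply: (H (Ordinal i7)).
Qed.

Lemma disjE s (t : seq nat) : [disjoint index_set s & index_set t]%B = disj s t.
Proof.
rewrite -finset.setI_eq0; apply/eqP/all_iotaP => [H i|H].
  by have /finset.setP /(_ i) := H; rewrite !inE => /negbT.
by apply/finset.setP => i; rewrite !inE; apply/negbTE/H.
Qed.

Lemma sameE s (t : seq nat) : (index_set s == index_set t) = same s t.
Proof.
apply/eqP/all_iotaP => [H i|H].
  by have /finset.setP /(_ i) := H; rewrite !inE => ->.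
by apply/finset.setP => i; rewrite !inE; apply/eqP/H.
Qed.

Lemma index_setU s (t : seq nat) : index_set s :|: index_set t = index_set (s ++ t).
Proof. by apply/finset.setP => i; rewrite !inE mem_cat. Qed.

Lemma index_setC s : ~: index_set s = index_set (compl s).
Proof.
by apply/finset.setP => i; rewrite !inE mem_filter mem_iota ltn_ord /= andbT.
Qed.

Lemma shuffle_signE s (t : seq nat) :
  shuffle_sign K (index_set s) (index_set t) = (-1) ^+ odd (inversions s t).
Proof.
rewrite signr_odd /shuffle_sign; congr (_ ^+ _).
rewrite -sum1_card /inversions sumnE big_map -[iota 0 7]/(index_iota 0 7).
rewrite big_mkord -(pair_big_dep xpredT
  (fun i j : 'I_7 => [&& i \in index_set s, j \in index_set t & (j < i)%N])
  (fun _ _ => 1%N)).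
apply: eq_bigr => i _; rewrite sumnE big_map big_mkord big_mkcond /=.
by apply: eq_bigr => j _; rewrite !inE; case: ifP.
Qed.

Lemma denote_wedge a l m : wedge (denote a l) (denote a m) = denote a (form_wedge l m).
Proof.
rewrite /denote wedge_suml /form_wedge big_flatten big_map; apply: eq_bigr => t _.
rewrite wedge_sumr big_map big_filter [RHS]big_mkcond; apply: eq_bigr => u _.
rewrite wedgeZl wedgeZr wedge_basis disjE; case: ifP => _ /=; last first.
  by apply/ffunP => I; rewrite !ffunE !mulr0.
rewrite extZA extZA index_setU; congr (extZ _ _).
rewrite shuffle_signE /monomial big_cat /= !signr_addb; ring.
Qed.

Lemma denote_hodge a l : hodge (denote a l) = denote a (form_hodge l).
Proof.
rewrite /denote hodge_sum /form_hodge big_map; apply: eq_bigr => t _.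
rewrite hodgeZ hodge_basis extZA index_setC; congr (extZ _ _).
by rewrite shuffle_signE /monomial /= !signr_addb; ring.
Qed.

Lemma denote_coef a l s :
  denote a l (index_set s) = \sum_(c <- form_coef l s) monomial a c.
Proof.
rewrite /denote sum_ffunE big_map big_filter [RHS]big_mkcond; apply: eq_bigr => t _.
by rewrite !ffunE eq_sym sameE; case: ifP; rewrite ?mulr1 ?mulr0.
Qed.

(** The premise on [l] can be decided by computation; it bounds the index sets that occur in a
    product. *)
Lemma denote_out a l (r : seq (seq nat)) (I : {set 'I_7}) :
  all (fun t => has (same t.2) r) l -> (forall s, s \in r -> I != index_set s) ->
  denote a l I = 0.
Proof.
move=> /allP lr Ir; rewrite /denote sum_ffunE big_seq big1 // => t /lr/hasP[s sr].
rewrite -sameE => /eqP ts; rewrite !ffunE ts (negbTE (Ir _ sr)) mulr0 //.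
Qed.

End FormList.

(** * The curvature equations in coordinates *)

Section G2.
Variable K : comNzRingType.
Implicit Type a : nat -> K.

Definition form_opp (l : form_list) : form_list := [seq (~~ t.1.1, t.1.2, t.2) | t <- l].

Lemma denote_cat a (l m : form_list) : denote a (l ++ m) = denote a l + denote a m.
Proof. by rewrite /denote big_cat. Qed.

Lemma denote_opp a (l : form_list) : denote a (form_opp l) = - denote a l.
Proof.
rewrite /denote big_map -sumrN; apply: eq_bigr => t _.
apply/ffunP => I; rewrite !ffunE /monomial -mulNr; case: t.1.1 => /=; ring.
Qed.

Definition covec_form (i : nat) : form_list := [:: (false, [::], [:: i])].

Lemma covec_denote a (i : 'I_7) : covec K i = denote a (covec_form i).
Proof.
rewrite /denote big_seq1; apply/ffunP => I; rewrite !ffunE /monomial big_nil !mul1r.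
congr (_ == _)%:R; apply/finset.setP => j; by rewrite !inE.
Qed.

Definition phi_form : form_list :=
  let d := covec_form in let w := form_wedge in
  w (w (d 0) (d 1)) (d 2) ++ w (d 0) (w (d 3) (d 4) ++ w (d 5) (d 6))
  ++ w (d 1) (w (d 3) (d 5) ++ w (d 6) (d 4))
  ++ w (d 2) (form_opp (w (d 3) (d 6) ++ w (d 4) (d 5))).

(** The terms of [phi_form] contain no variables, so [a] is free and can be the environment of the
    curvature with which phi is multiplied. *)
Lemma phi_denote a : g2_phi K = denote a phi_form.
Proof.
rewrite /phi_form !(denote_cat, denote_opp, =^~ denote_wedge) /g2_phi.
rewrite /omega1 /omega2 /omega3 /dx /dy !(covec_denote a) /= -!addrA.
by [].
Qed.

(** Variable number [4 * i + j] is the [i]-th partial derivative of the [j]-th component of f. *)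
Definition curv_form : form_list :=
  [seq (false, [:: 4 * i + j], [:: i; 3 + j]) | i <- iota 0 3, j <- iota 0 4].

Definition curv a : ext K :=
  \sum_(i < 3) \sum_(j < 4) extZ (a (4 * i + j)%N) (wedge (dx K i) (dy K j)).

Lemma curv_denote a : curv a = denote a curv_form.
Proof.
rewrite /denote big_flatten big_map -[iota 0 3]/(index_iota 0 3) big_mkord.
apply: eq_bigr => i _; rewrite big_map -[iota 0 4]/(index_iota 0 4) big_mkord.
apply: eq_bigr => j _; rewrite /monomial big_seq1 mul1r.
rewrite /dx /dy !(covec_denote a) denote_wedge; congr (extZ _ _).
rewrite /denote /form_wedge /= (_ : disj _ _); last first.
  by case: i j => [[|[|[|]]]] // ? [[|[|[|[|]]]]].
rewrite big_seq1 /monomial big_nil mulr1 (_ : odd _ = false) /=; last first.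
  by case: i j => [[|[|[|]]]] // ? [[|[|[|[|]]]]].
by apply/ffunP => I; rewrite !ffunE mul1r.
Qed.

(** Both equations are between 6-forms, whose basis elements are named here by the index they
    omit. *)
Definition missing (k : nat) : seq nat := [seq i <- iota 0 7 | i != k].

Definition minor3 a (i j k : nat) : K :=
  a i * (a (4 + j)%N * a (8 + k)%N - a (4 + k)%N * a (8 + j)%N)
  - a j * (a (4 + i)%N * a (8 + k)%N - a (4 + k)%N * a (8 + i)%N)
  + a k * (a (4 + i)%N * a (8 + j)%N - a (4 + j)%N * a (8 + i)%N).

Definition cubic_part a (k : nat) : K :=
  match k with
  | 0 => minor3 a 1 2 3 | 1 => minor3 a 0 2 3 | 2 => minor3 a 0 1 3 | _ => minor3 a 0 1 2
  end.

(** With the signs [(-1)^k], [linear_part] is the Dirac operator sum_i J_i d_i f, where J_i is the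
    skew matrix of omega_i, and [cubic_part] is, up to sign, the triple cross product in R^4 of the
    three partial derivatives of f. *)
Definition linear_part a (k : nat) : K :=
  match k with
  | 0 => a 1%N + a 6%N - a 11%N | 1 => a 0%N + a 7%N + a 10%N
  | 2 => a 3%N - a 4%N + a 9%N | _ => a 2%N - a 5%N - a 8%N
  end.

(** The list of monomials is closed data and is evaluated first, so that [ring] meets only a
    polynomial in the values of [a]. *)
Ltac compute_coefs :=
  rewrite denote_coef;
  match goal with |- context [form_coef ?l ?s] =>
    let v := eval vm_compute in (form_coef l s) in
    rewrite (_ : form_coef l s = v); last by vm_compute
  end;
  rewrite /monomial ?(big_cons, big_nil) /= ?(big_cons, big_nil) /=.

(** The 6 counts the orders of the three factors; the sign comes from moving the three dx in front
    of the three dy. *)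
Lemma curv_cube_coef a (k : 'I_4) :
  wedge_exp (curv a) 3 (index_set (missing (3 + k))) = - 6%:R * cubic_part a k.
Proof.
rewrite /wedge_exp /= curv_denote !denote_wedge.
by case: k => [[|[|[|[|//]]]] k4]; compute_coefs; rewrite /minor3 /=; ring.
Qed.

Lemma curv_hodge_coef a (k : 'I_4) :
  wedge (curv a) (hodge (g2_phi K)) (index_set (missing (3 + k))) = linear_part a k.
Proof.
rewrite curv_denote (phi_denote a) denote_hodge denote_wedge.
by case: k => [[|[|[|[|//]]]] k4]; compute_coefs; ring.
Qed.

Lemma curv_cube_out a (I : {set 'I_7}) :
  (forall k : 'I_4, I != index_set (missing (3 + k))) -> wedge_exp (curv a) 3 I = 0.
Proof.
move=> Ik; rewrite /wedge_exp /= curv_denote !denote_wedge.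
apply: (@denote_out _ _ _ [seq missing (3 + k) | k <- iota 0 4]); first by vm_compute.
by move=> s /mapP[k]; rewrite mem_iota => /= k4 ->; apply: (Ik (Ordinal k4)).
Qed.

(** The term dy^4567 of the dual of phi is killed by every dy, and the other terms contain two dx,
    so the product contains all three. *)
Lemma curv_hodge_out a (I : {set 'I_7}) :
  (forall k : 'I_4, I != index_set (missing (3 + k))) ->
  wedge (curv a) (hodge (g2_phi K)) I = 0.
Proof.
move=> Ik; rewrite curv_denote (phi_denote a) denote_hodge denote_wedge.
apply: (@denote_out _ _ _ [seq missing (3 + k) | k <- iota 0 4]); first by vm_compute.
by move=> s /mapP[k]; rewrite mem_iota => /= k4 ->; apply: (Ik (Ordinal k4)).
Qed.

(** The left side is quadratic in [a]. The quartic part of the right side vanishes, being the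
    Laplace expansion of a 4x4 determinant in which row [i] occurs twice; this is why [cubic_part]
    can be added to [linear_part]. *)
Lemma curv_square_coef a (i : 'I_3) :
  wedge (g2_phi K) (hodge (wedge_exp (curv a) 2)) (index_set (missing i)) =
  (-1) ^+ i.+1 * 2%:R *
    \sum_(k < 4) (-1) ^+ k * a (4 * i + k)%N * (linear_part a k + cubic_part a k).
Proof.
rewrite /wedge_exp /= curv_denote (phi_denote a) denote_wedge denote_hodge denote_wedge.
rewrite !big_ord_recl big_ord0.
by case: i => [[|[|[|//]]] i3]; compute_coefs; rewrite /minor3 /bump /=; ring.
Qed.

(** Counting dx and dy, the square has type (2, 2) and its dual type (1, 2). The term dx^123 of phi
    kills the dual, and the terms of type (1, 2) yield type (2, 4). *)
Lemma curv_square_out a (I : {set 'I_7}) :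
  (forall k : 'I_3, I != index_set (missing k)) ->
  wedge (g2_phi K) (hodge (wedge_exp (curv a) 2)) I = 0.
Proof.
move=> Ik.
rewrite /wedge_exp /= curv_denote (phi_denote a) denote_wedge denote_hodge denote_wedge.
apply: (@denote_out _ _ _ [seq missing k | k <- iota 0 3]); first by vm_compute.
by move=> s /mapP[k]; rewrite mem_iota => /= k3 ->; apply: (Ik (Ordinal k3)).
Qed.

End G2.

(** * The calibration on the frame of the graph *)

Section Frame.
Variable R : comNzRingType.

Definition det3 (m : nat -> nat -> R) : R :=
  m 0%N 0%N * (m 1%N 1%N * m 2%N 2%N - m 1%N 2%N * m 2%N 1%N)
  - m 0%N 1%N * (m 1%N 0%N * m 2%N 2%N - m 1%N 2%N * m 2%N 0%N)
  + m 0%N 2%N * (m 1%N 0%N * m 2%N 1%N - m 1%N 1%N * m 2%N 0%N).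

Lemma det33 (M : 'M[R]_3) (m : nat -> nat -> R) :
  (forall i j : 'I_3, M i j = m i j) -> \det M = det3 m.
Proof.
rewrite (expand_det_row _ 0) !big_ord_recl big_ord0 /cofactor.
rewrite !(expand_det_row _ 0) !big_ord_recl !big_ord0 /cofactor !det_mx11 !mxE.
move=> mE; rewrite !mE /det3 /= /bump /= !(addn0, add0n, addn1); ring.
Qed.

Definition entries (A : 'M[R]_(3, 4)) (n : nat) : R := A (inord (n %/ 4)) (inord (n %% 4)).

Lemma entriesE (A : 'M[R]_(3, 4)) (i : 'I_3) (j : 'I_4) :
  entries A (4 * i + j) = A i j.
Proof.
by rewrite /entries mulnC divnMDl // divn_small ?addn0 // modnMDl modn_small // !inord_val.
Qed.

Definition graph_frame (A : 'M[R]_(3, 4)) : 'M[R]_(3, 3 + 4) := row_mx 1%:M A.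

Lemma graph_frameE (A : 'M[R]_(3, 4)) (i : 'I_3) (j : nat) : (j < 7)%N ->
  graph_frame A i (inord j) =
  if (j < 3)%N then (val i == j)%:R else entries A (4 * i + (j - 3)).
Proof.
move=> j7; rewrite /graph_frame mxE; case: splitP => k; rewrite inordK // => ->.
  by rewrite ltn_ord mxE -val_eqE.
by rewrite ltnNge leq_addr /= addKn entriesE.
Qed.

Lemma gram_graph_frame (A : 'M[R]_(3, 4)) :
  graph_frame A *m (graph_frame A)^T = 1%:M + A *m A^T.
Proof. by rewrite /graph_frame tr_row_mx mul_row_col trmx1 mulmx1. Qed.

(** Selecting columns commutes with multiplication on the left. Every triple of tangent vectors has
    the form [C *m graph_frame A], so phi need only be known on the graph frame. *)
Lemma ext_eval_mulmx (k : nat) (u : ext R) (C : 'M[R]_k) (V : 'M[R]_(k, 7)) :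
  ext_eval u (C *m V) = \det C * ext_eval u V.
Proof.
rewrite /ext_eval mulr_sumr; apply: eq_bigr => I _.
rewrite mulrCA -det_mulmx; congr (_ * \det _).
by apply/matrixP => i j; rewrite !mxE; apply: eq_bigr => l _; rewrite !mxE.
Qed.

(** Filtering [iota] sorts [s] into the increasing order in which [enum] lists the columns. *)
Lemma ext_eval_basis (k : nat) (s : seq nat) (V : 'M[R]_(k, 7)) :
  let c := [seq i <- iota 0 7 | i \in s] in
  size c = k ->
  ext_eval (ext_basis R (index_set s)) V = \det (\matrix_(i, j) V i (inord (nth 0%N c j))).
Proof.
move=> c sc.
have enumE : map val (enum (index_set s)) = c.
  rewrite /c -val_enum_ord filter_map; congr (map _ _); rewrite {1}/enum_mem -enumT.
  by apply: eq_filter => i; rewrite /= inE.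
have cardI : #|index_set s| = k by rewrite cardE -sc -enumE size_map.
rewrite /ext_eval (bigD1 (index_set s)) ?cardI //= big1 => [|I /andP[_ Is]]; last first.
  by rewrite ffunE (negbTE Is) mul0r.
rewrite ffunE eqxx mul1r addr0; congr (\det _); apply/matrixP => i j; rewrite !mxE.
congr (V i _); apply: val_inj; rewrite /= -enumE (nth_map ord0) ?inord_val //.
by rewrite -(size_map val) enumE sc.
Qed.

Lemma ext_eval_denote (k : nat) (a : nat -> R) (l : form_list) (V : 'M[R]_(k, 7)) :
  ext_eval (denote a l) V =
  \sum_(t <- l) monomial a t.1 * ext_eval (ext_basis R (index_set t.2)) V.
Proof.
rewrite /ext_eval /denote; under eq_bigr do rewrite sum_ffunE mulr_suml.
rewrite exchange_big; apply: eq_bigr => t _ /=; rewrite mulr_sumr.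
by apply: eq_bigr => I _; rewrite ffunE mulrA.
Qed.

Definition chi (A : 'M[R]_(3, 4)) (k : nat) : R :=
  linear_part (entries A) k + cubic_part (entries A) k.

Lemma ext_eval_graph_frame (A : 'M[R]_(3, 4)) (s : seq nat) :
  let c := [seq i <- iota 0 7 | i \in s] in
  size c = 3%N ->
  ext_eval (ext_basis R (index_set s)) (graph_frame A) =
  det3 (fun i j => if (nth 0%N c j < 3)%N then (i == nth 0%N c j)%:R
                   else entries A (4 * i + (nth 0%N c j - 3))).
Proof.
move=> c sc; rewrite ext_eval_basis //; apply: det33 => i j.
rewrite mxE graph_frameE // -/c.
have : nth 0%N c j \in c by rewrite mem_nth // sc.
by rewrite mem_filter mem_iota => /andP[].
Qed.

(* The Harvey-Lawson identity: up to sign, [(-1)^k chi A k] is the component of tau(M) along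
   [dy k], and the inner sums are its components along [dx i]. *)
Lemma det_gram_graph_frame (A : 'M[R]_(3, 4)) :
  \det (graph_frame A *m (graph_frame A)^T) =
  ext_eval (g2_phi R) (graph_frame A) ^+ 2 + \sum_(k < 4) chi A k ^+ 2
  + \sum_(i < 3) (\sum_(k < 4) (-1) ^+ k * A i k * chi A k) ^+ 2.
Proof.
set a := entries A.
rewrite gram_graph_frame (@det33 _ (fun i j => (i == j)%:R +
  \sum_(k < 4) a (4 * i + k)%N * a (4 * j + k)%N)); last first.
  move=> i j; rewrite !mxE -val_eqE; congr (_ + _); apply: eq_bigr => k _.
  by rewrite !mxE /a !entriesE.
under [X in _ = _ + X]eq_bigr do under eq_bigr do rewrite -entriesE -/a.
rewrite (phi_denote a) ext_eval_denote.
let v := eval vm_compute in phi_form in rewrite (_ : phi_form = v); last by vm_compute.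
rewrite !big_cons big_nil !ext_eval_graph_frame // /monomial !big_nil -/a.
rewrite /det3 /chi -/a.
rewrite !big_ord_recl !big_ord0 /= /bump /=.
rewrite /minor3.
(* Both sides are now polynomials in the twelve entries of [A], treated as atoms. *)
set u0 := a 0%N; set u1 := a 1%N; set u2 := a 2%N; set u3 := a 3%N.
set u4 := a 4%N; set u5 := a 5%N; set u6 := a 6%N; set u7 := a 7%N.
set u8 := a 8%N; set u9 := a 9%N; set u10 := a 10%N; set u11 := a 11%N.
ring.
Qed.
End Frame.

(** Applied to the embedding of R in R[i], this turns the complex coefficients into real ones. *)
Lemma chi_rmorph (K L : comNzRingType) (h : {rmorphism K -> L}) (a : nat -> K) (k : nat) :
  linear_part (h \o a) k + cubic_part (h \o a) k = h (linear_part a k + cubic_part a k).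
Proof.
by rewrite /linear_part /cubic_part /minor3; case: k => [|[|[|k]]] /=;
  rewrite !(rmorphD, rmorphM, rmorphN).
Qed.

(** * The equations for the complex curvature form *)

Section Curvature.
Variables (R : realType) (f : 'rV[R]_3 -> torus R).
Implicit Type p : ambient R.

Definition torus_jacobian (x : 'rV[R]_3) : 'M[R]_(3, 4) := \matrix_(i, a) torus_partial f a i x.

Lemma curvatureE p :
  curvature f p = extZ (Complex 0 1)
    (curv (real_complex R \o entries (torus_jacobian p.1))).
Proof.
rewrite /curvature; apply/ffunP => I; rewrite !ffunE !sum_ffunE; congr (_ * _).
apply: eq_bigr => i _; rewrite !sum_ffunE; apply: eq_bigr => j _.
by rewrite !ffunE /comp entriesE mxE.
Qed.

Lemma cubic_eqP p :
  6^-1 *: wedge_exp (curvature f p) 3 + wedge (curvature f p) (hodge (g2_phi R[i])) = 0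
  <-> forall k : 'I_4, chi (torus_jacobian p.1) k = 0.
Proof.
rewrite curvatureE; set a := entries _; set c := Complex 0 1.
set G := curv _.
have c2 : c * c = -1 by rewrite -expr2; exact: sqr_i.
(* Cubing turns [c] into [-c], whence the coefficient [- 6^-1], which cancels the [- 6] of
   [curv_cube_coef]. *)
have cubicE : 6^-1 *: wedge_exp (extZ c G) 3 +
    wedge (extZ c G) (hodge (g2_phi R[i])) =
    extZ c (extZ (- 6^-1) (wedge_exp G 3) + wedge G (hodge (g2_phi R[i]))).
  apply/ffunP => I.
  rewrite /wedge_exp /= !(wedgeZl, wedgeZr) !ffunE /GRing.scale /=.
  rewrite mulrDr; congr (_ + _); rewrite (mulrA c c) c2; ring.
rewrite cubicE; set W := extZ c _.
have coefE (k : 'I_4) : W (index_set (missing (3 + k))) =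
    c * real_complex R (chi (torus_jacobian p.1) k).
  rewrite /W extZE extDE extZE curv_cube_coef curv_hodge_coef mulrA mulrNN mulVf ?pnatr_eq0 //.
  by rewrite mul1r addrC chi_rmorph.
split=> [H k|H].
  have /esym/eqP := coefE k; rewrite H ffunE mulf_eq0 => /orP[|].
    by move/eqP => c0; move: c2; rewrite c0 mul0r => /esym/eqP; rewrite oppr_eq0 oner_eq0.
  by rewrite fmorph_eq0 => /eqP.
suff W0 I : W I = 0 by apply/ffunP => I; rewrite [RHS]ffunE; exact: W0.
have [[k ->]|Ik] := pselect (exists k : 'I_4, I = index_set (missing (3 + k))).
  by rewrite coefE H rmorph0 mulr0.
have {}Ik (k : 'I_4) : I != index_set (missing (3 + k)).
  by apply/eqP => IE; apply: Ik; exists k.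
by rewrite /W extZE extDE extZE /G curv_cube_out // curv_hodge_out // !mulr0 addr0 mulr0.
Qed.

Lemma chi_square_eq p : (forall k : 'I_4, chi (torus_jacobian p.1) k = 0) ->
  wedge (g2_phi R[i]) (hodge (wedge_exp (curvature f p) 2)) = 0.
Proof.
move=> H; rewrite curvatureE; set a := entries _; set c := Complex 0 1.
rewrite /wedge_exp /= wedgeZl wedgeZr extZA hodgeZ wedgeZr.
apply/ffunP => I; rewrite ffunE [RHS]ffunE -[wedge (curv _) _]/(wedge_exp (curv _) 2).
have [[k ->]|Ik] := pselect (exists k : 'I_3, I = index_set (missing k)).
  rewrite curv_square_coef big1 ?mulr0 // => j _.
  by rewrite chi_rmorph; have := H j; rewrite /chi -/a => ->; rewrite rmorph0 mulr0.
by rewrite curv_square_out ?mulr0 // => k; apply/eqP => IE; apply: Ik; exists k.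
Qed.

End Curvature.

(** * Smooth maps *)

Section SmoothCalculus.
Variable R : realType.

Lemma cvg_sumr (T I : Type) (F : set_system T) {FF : Filter F}
    (W : normedModType R) (r : seq I) (P : pred I) (u : I -> T -> W) (l : I -> W) :
  (forall i, P i -> u i x @[x --> F] --> l i) ->
  \sum_(i <- r | P i) u i x @[x --> F] --> \sum_(i <- r | P i) l i.
Proof. by move=> ul; apply: cvg_big => // ; exact: add_continuous. Qed.

Lemma cvg_prodr (T I : Type) (F : set_system T) {FF : Filter F}
    (r : seq I) (P : pred I) (u : I -> T -> R) (l : I -> R) :
  (forall i, P i -> u i x @[x --> F] --> l i) ->
  \prod_(i <- r | P i) u i x @[x --> F] --> \prod_(i <- r | P i) l i.
Proof. by move=> ul; apply: cvg_big => // ; exact: mul_continuous. Qed.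

Lemma mx_linear_continuous (m n : nat) (W : normedModType R)
  (h : {linear 'M[R]_(m, n) -> W}) : continuous h.
Proof.
have -> : (h : _ -> _) = fun M => \sum_i \sum_j M i j *: h (delta_mx i j).
  apply/funext => M; rewrite {1}[M]matrix_sum_delta linear_sum; apply: eq_bigr => i _.
  by rewrite linear_sum; apply: eq_bigr => j _; rewrite linearZ.
move=> M.
apply: (@cvg_sumr _ _ _ (nbhs_filter M)) => i _.
apply: (@cvg_sumr _ _ _ (nbhs_filter M)) => j _.
by apply: cvgZr_tmp; apply: coord_continuous.
Qed.

Lemma mx_continuous (T : topologicalType) (m n : nat) (F : T -> 'M[R]_(m, n)) (x : T) :
  (forall i j, {for x, continuous (fun z => F z i j)}) -> {for x, continuous F}.
Proof.
move=> Fx; have -> : F = fun z => \sum_i \sum_j F z i j *: delta_mx i j.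
  by apply/funext => z; apply: matrix_sum_delta.
apply: (@cvg_sumr _ _ _ (nbhs_filter x)) => i _.
apply: (@cvg_sumr _ _ _ (nbhs_filter x)) => j _.
by apply: cvgZr_tmp; apply: Fx.
Qed.

Lemma det_continuous (T : topologicalType) (n : nat) (F : T -> 'M[R]_n) (x : T) :
  (forall i j, {for x, continuous (fun z => F z i j)}) ->
  {for x, continuous (fun z => \det (F z))}.
Proof.
move=> Fx; apply: (@cvg_sumr _ _ _ (nbhs_filter x)) => s _.
apply: cvgM; first exact: cvg_cst.
by apply: (@cvg_prodr _ _ _ (nbhs_filter x)) => i _; apply: Fx.
Qed.

Lemma ext_eval_continuous (T : topologicalType) (k : nat) (u : ext R)
    (F : T -> 'M[R]_(k, 7)) (x : T) :
  (forall i j, {for x, continuous (fun z => F z i j)}) ->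
  {for x, continuous (fun z => ext_eval u (F z))}.
Proof.
move=> Fx; apply: (@cvg_sumr _ _ _ (nbhs_filter x)) => I _.
apply: cvgM; first exact: cvg_cst.
apply: det_continuous => i j.
have -> : (fun z => (\matrix_(i0, j0) F z i0 (nth ord0 (enum I) j0)) i j) =
    fun z => F z i (nth ord0 (enum I) j) by apply/funext => z; rewrite mxE.
exact: Fx.
Qed.

Lemma near_eq_continuous (T T' : topologicalType) (u w : T -> T') (x : T) :
  {near x, u =1 w} -> {for x, continuous u} -> {for x, continuous w}.
Proof.
move=> uw; rewrite /prop_for /continuous_at (nbhs_singleton uw); apply: cvg_trans.
by apply: near_eq_cvg; apply: filterS uw => z ->.
Qed.

(** * Closure properties of C^k maps *)

Section Ck.
Variables V W : normedModType R.
Implicit Types (U : set V).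

Lemma Ck_on_ext (k : nat) U (f g : V -> W) : open U ->
  (forall x, U x -> f x = g x) -> Ck_on k U f -> Ck_on k U g.
Proof.
move=> oU; have near_fg (u w : V -> W) x : (forall x, U x -> u x = w x) -> U x -> {near x, u =1 w}.
  by move=> uw Ux; apply: filterS (open_nbhs_nbhs (conj oU Ux)) => z; apply: uw.
elim: k f g => [|k IH] f g fg [fc fd].
  by split=> // x Ux; apply: near_eq_continuous (near_fg _ _ _ fg Ux) (fc x Ux).
split=> [x Ux|v]; first exact: near_eq_continuous (near_fg _ _ _ fg Ux) (fc x Ux).
have [fdv fCk] := fd v; split.
  by move=> x Ux; apply: near_eq_derivable (near_fg _ _ _ fg Ux) (fdv x Ux).
by apply: IH fCk => x Ux; apply: near_eq_derive; apply: near_fg.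
Qed.

Lemma Ck_on_cst (k : nat) U (c : W) : Ck_on k U (fun=> c).
Proof.
elim: k c => [|k IH] c; first by split=> // x _; apply: cvg_cst.
split=> [x _|v]; first exact: cvg_cst.
split=> [x _|]; first exact: derivable_cst.
have -> : 'D_v (fun=> c : W) = fun=> 0 by apply/funext => x; apply: derive_cst.
exact: IH.
Qed.

Lemma Ck_on_add (k : nat) U (f g : V -> W) : open U ->
  Ck_on k U f -> Ck_on k U g -> Ck_on k U (fun x => f x + g x).
Proof.
move=> oU; elim: k f g => [|k IH] f g [fc fd] [gc gd].
  by split=> // x Ux; apply: cvgD; [apply: fc|apply: gc].
split=> [x Ux|v]; first by apply: cvgD; [apply: fc|apply: gc].
have [fdv fCk] := fd v; have [gdv gCk] := gd v.
split=> [x Ux|]; first by apply: derivableD; [apply: fdv|apply: gdv].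
apply: Ck_on_ext (IH _ _ fCk gCk) => // x Ux.
by rewrite -deriveD //; [apply: fdv|apply: gdv].
Qed.

End Ck.

Section CkComposition.
Variables V V' W W' : normedModType R.
Implicit Types (U : set V).

Lemma derive_linear_comp (h : {linear W -> W'}) (f : V -> W) (x v : V) :
  continuous h -> derivable f x v ->
  derivable (h \o f) x v /\ 'D_v (h \o f) x = h ('D_v f x).
Proof.
move=> hc fd.
suff H : t^-1 *: (((h \o f) \o shift x) (t *: v) - (h \o f) x) @[t --> 0^'] -->
    h ('D_v f x).
  split; first by apply/cvg_ex; exists (h ('D_v f x)).
  by apply: (cvg_lim _ H); apply: norm_hausdorff.
have -> : (fun t => t^-1 *: (((h \o f) \o shift x) (t *: v) - (h \o f) x)) =
    h \o (fun t => t^-1 *: ((f \o shift x) (t *: v) - f x)).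
  by apply/funext => t; rewrite /= linearZZ (linearB h).
have fd' : (fun t => t^-1 *: ((f \o shift x) (t *: v) - f x)) @ 0^' --> 'D_v f x by [].
exact: (cvg_comp _ _ fd' (hc _)).
Qed.

(** A directional derivative of [h \o f] is again [h] after a derivative of [f], so the induction
    closes without a general chain rule. *)
Lemma Ck_on_linear_comp (k : nat) U (h : {linear W -> W'}) (f : V -> W) :
  open U -> continuous h -> Ck_on k U f -> Ck_on k U (h \o f).
Proof.
move=> oU hc; elim: k f => [|k IH] f [fc fd].
  by split=> // x Ux; apply: continuous_comp; [apply: fc|apply: hc].
split=> [x Ux|v]; first by apply: continuous_comp; [apply: fc|apply: hc].
have [fdv fCk] := fd v; split=> [x Ux|].
  by have [] := derive_linear_comp hc (fdv x Ux).
apply: Ck_on_ext (IH _ fCk) => // x Ux.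
by have [_ ->] := derive_linear_comp hc (fdv x Ux).
Qed.

(** The difference quotients agree before any limit is taken, so the derivative formula below holds
    with no differentiability of [g]. *)
Lemma affine_comp_quotient (h : {linear V -> V'}) (b : V') (g : V' -> W) (x v : V) :
  (fun t : R => t^-1 *: ((g \o shift (h x + b)) (t *: h v) - g (h x + b))) =
  (fun t => t^-1 *: (((fun x => g (h x + b)) \o shift x) (t *: v) - g (h x + b))).
Proof. by apply/funext => t /=; rewrite (linearD h) (linearZZ h) addrA. Qed.

Lemma derive_affine_comp (h : {linear V -> V'}) (b : V') (g : V' -> W) (v : V) :
  'D_v (fun x => g (h x + b)) = (fun x => 'D_(h v) g (h x + b)).
Proof. by apply/funext => x; rewrite /derive affine_comp_quotient. Qed.

Lemma derivable_affine_comp (h : {linear V -> V'}) (b : V') (g : V' -> W) (x v : V) :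
  derivable g (h x + b) (h v) -> derivable (fun x => g (h x + b)) x v.
Proof. by rewrite /derivable affine_comp_quotient. Qed.

Lemma Ck_on_affine_comp (k : nat) U (U' : set V') (h : {linear V -> V'}) (b : V')
    (g : V' -> W) : continuous h -> (forall x, U x -> U' (h x + b)) ->
  Ck_on k U' g -> Ck_on k U (fun x => g (h x + b)).
Proof.
move=> hc UU'; have cont (g' : V' -> W) x : {for (h x + b), continuous g'} ->
    {for x, continuous (fun x => g' (h x + b))}.
  move=> gc; apply: (@continuous_comp _ _ _ (fun x => h x + b) g') gc.
  exact: (cvgD (hc x) (cvg_cst b)).
elim: k g => [|k IH] g [gc gd].
  by split=> // x Ux; apply: cont; apply/gc/UU'.
split=> [x Ux|v]; first by apply: cont; apply/gc/UU'.
have [gdv gCk] := gd (h v); split=> [x Ux|].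
  exact: (derivable_affine_comp (gdv _ (UU' x Ux))).
rewrite derive_affine_comp; exact: (IH _ gCk).
Qed.

Lemma is_derive_affine (h : {linear V -> W}) (b : W) (x v : V) :
  continuous h -> is_derive x v (fun x => h x + b) (h v).
Proof.
move=> hc; have diffh : differentiable (h : V -> W) x by apply: linear_differentiable.
have -> : h v = h v + 0 by rewrite addr0.
apply: is_deriveD; apply: DeriveDef; first exact: diff_derivable.
by rewrite deriveE // diff_lin.
Qed.

Lemma Ck_on_affine (k : nat) (U : set V) (h : {linear V -> W}) (b : W) :
  continuous h -> Ck_on k U (fun x => h x + b).
Proof.
move=> hc.
have cont x : {for x, continuous (fun x => h x + b)}.
  exact: (cvgD (hc x) (cvg_cst b)).
case: k => [|k]; split => // v; split => [x _|].
  by have [] := is_derive_affine b x v hc.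
have -> : 'D_v (fun x => h x + b) = fun=> h v.
  by apply/funext => x; have [] := is_derive_affine b x v hc.
exact: Ck_on_cst.
Qed.

End CkComposition.
End SmoothCalculus.

(** * Differentiability from continuous partial derivatives *)

Section Differentiability.
Variable R : realType.

Section Line.
Variable (V : normedModType R) (v : V).

Let line_is_linear : linear ( *:%R^~ v : R -> V).
Proof. by move=> a s t; rewrite scalerDl scalerA. Qed.

Definition line : {linear R -> V} :=
  HB.pack ( *:%R^~ v : R -> V) (GRing.isLinear.Build _ _ _ _ _ line_is_linear).

Lemma lineE (t : R) : line t = t *: v. Proof. by []. Qed.

Lemma continuous_line : continuous line.
Proof. exact: scalel_continuous. Qed.

End Line.

Lemma mean_value_bound (g : R -> R) (s d e : R) :
  (forall t, `|t| <= `|s| -> derivable g t 1 /\ `|'D_1 g t - d| <= e) ->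
  `|g s - g 0 - s * d| <= e * `|s|.
Proof.
move=> gd.
have within_s a b : a <= b -> - `|s| <= a -> b <= `|s| ->
    exists2 c, c \in `[a, b]%R & g b - g a = 'D_1 g c * (b - a).
  move=> ab sa bs; apply: MVT_segment => // [t|].
    rewrite in_itv /= => /andP[t1 t2]; apply: derivableP.
    by apply: (gd t _).1; rewrite ler_norml (le_trans sa (ltW t1)) (le_trans (ltW t2)).
  apply: derivable_within_continuous => t; rewrite in_itv /= => /andP[t1 t2].
  by apply: (gd t _).1; rewrite ler_norml (le_trans sa t1) (le_trans t2).
have [s0|s0] := leP 0 s.
  have [||c] := within_s 0 s s0; rewrite ?oppr_le0 ?ler_norm //.
  rewrite in_itv /= subr0 => /andP[c1 c2] ->.
  rewrite mulrC -mulrBr normrM mulrC ler_wpM2r //.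
  by apply: (gd c _).2; rewrite !ger0_norm.
have [|||c] := within_s s 0; rewrite ?(ltW s0) ?normr_ge0 ?(ltr0_norm s0) ?opprK //.
rewrite in_itv /= sub0r => /andP[c1 c2] gE.
have -> : g s - g 0 = s * 'D_1 g c by rewrite -opprB gE mulrN opprK mulrC.
rewrite -mulrBr normrM mulrC (ltr0_norm s0) ler_wpM2r ?oppr_ge0 ?(ltW s0) //.
by apply: (gd c _).2; rewrite (ltr0_norm s0) ler0_norm // lerN2.
Qed.

Lemma differentiable_approx (V W : normedModType R) (f : V -> W) (df : {linear V -> W})
    (x : V) : continuous df ->
  (forall e, 0 < e -> \forall h \near (0 : V), `|f (h + x) - f x - df h| <= e * `|h|) ->
  differentiable f x.
Proof.
move=> dfc H.
have fE : f \o shift x = cst (f x) + df +o_ (0 : V) id.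
  apply/eqaddoP => _/posnumP[e]; apply: filterS (H e%:num (gt0 e)) => h.
  by rewrite -[(_ - _) h]/(f (h + x) - (f x + df h)) opprD addrA.
by apply/diff_locallyP; rewrite (diff_unique dfc fE).
Qed.

Section Partial.
Variable n : nat.
Implicit Types h : 'rV[R]_n.

Section RowForm.
Variable c : 'I_n -> R.

Let row_form_is_linear : linear (fun h : 'rV[R]_n => \sum_i h 0 i * c i : R).
Proof.
move=> a s t; rewrite scaler_sumr -big_split; apply: eq_bigr => i _ /=.
by rewrite !mxE mulrDl /GRing.scale /= mulrA.
Qed.

Definition row_form : {linear 'rV[R]_n -> R} :=
  HB.pack (fun h : 'rV[R]_n => \sum_i h 0 i * c i : R)
    (GRing.isLinear.Build _ _ _ _ _ row_form_is_linear).

End RowForm.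

(** The vertices of a path from 0 to [h] whose edges are parallel to the axes. *)
Definition truncate h (k : nat) : 'rV[R]_n := \row_j (if (j < k)%N then h 0 j else 0).

Lemma truncate0 h : truncate h 0 = 0.
Proof. by apply/rowP => j; rewrite !mxE. Qed.

Lemma truncate_all h : truncate h n = h.
Proof. by apply/rowP => j; rewrite !mxE ltn_ord. Qed.

Lemma truncateS h (k : 'I_n) : truncate h k.+1 = h 0 k *: delta_mx 0 k + truncate h k.
Proof.
apply/rowP => j; rewrite !mxE eqxx /= ltnS leq_eqVlt.
case: (eqVneq j k) => [->|jk]; first by rewrite !eqxx ltnn mulr1 addr0.
by rewrite (_ : (j == k :> nat) = false) ?mulr0 ?add0r //; apply: negbTE.
Qed.

(** The increment of [f] telescopes along the axis-parallel path, and the mean value theorem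
    compares each edge with one partial derivative at [x]. *)
Lemma differentiable_partial (f : 'rV[R]_n -> R) (U : set 'rV[R]_n) (x : 'rV[R]_n) :
  open U -> U x ->
  (forall z i, U z -> derivable f z (delta_mx 0 i)) ->
  (forall i, {for x, continuous ('D_(delta_mx 0 i) f)}) -> differentiable f x.
Proof.
move=> oU Ux fd fc.
pose D := row_form (fun i => 'D_(delta_mx 0 i) f x).
have Dc : continuous D by apply: mx_linear_continuous.
apply: (differentiable_approx Dc) => eps eps0.
(* There are [n] edges with error at most [e * |h|] each; the successor keeps the denominator
   nonzero when [n] is 0. *)
pose e := eps / n.+1%:R.
have e0 : 0 < e by rewrite divr_gt0.
have : \forall z \near x, U z /\
    forall i, `|'D_(delta_mx 0 i) f z - 'D_(delta_mx 0 i) f x| <= e.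
  apply: filterI; first exact: (open_nbhs_nbhs (conj oU Ux)).
  apply: (@filter_forall _ _ (fun i z =>
    `|'D_(delta_mx 0 i) f z - 'D_(delta_mx 0 i) f x| <= e) _ (nbhs_filter x)) => i.
  have /cvgrPdist_le /(_ e e0) := fc i.
  by apply: filterS => z; rewrite distrC.
move=> /nbhs_ballP[r /= r0 ball_x].
near=> h.
have hr : forall i, `|h 0 i| < r.
  move=> i; have hr : ball 0 r h by near: h; apply: nbhsx_ballx.
  by have [_ /(_ 0 i)] := hr; rewrite /ball /= mxE sub0r normrN.
have hn i : `|h 0 i| <= `|h|.
  by rewrite [leRHS]/Num.Def.normr /= mx_normrE; apply: (le_bigmax _ (fun ij => `|h ij.1 ij.2|) (0, i)).
pose F k := f (truncate h k + x).
have stepE (k : 'I_n) : `|F k.+1 - F k - h 0 k * 'D_(delta_mx 0 k) f x| <= e * `|h|.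
  pose g t := f (line (delta_mx 0 k) t + (truncate h k + x)).
  have gE : F k.+1 - F k = g (h 0 k) - g 0.
    by rewrite /F /g truncateS !lineE scale0r add0r addrA.
  rewrite gE; apply: le_trans (ler_wpM2l (ltW e0) (hn k)).
  apply: mean_value_bound => t tk.
  set z := line (delta_mx 0 k) t + (truncate h k + x).
  (* Each coordinate of [z - x] is 0, [t] or a coordinate of [h], hence smaller than [r]. *)
  have [Uz dz] : U z /\
    forall i, `|'D_(delta_mx 0 i) f z - 'D_(delta_mx 0 i) f x| <= e.
    apply: ball_x; split => // i j; rewrite ord1 /ball /= /z lineE !mxE eqxx /=.
    rewrite addrA [X in _ - X]addrC opprD addrA subrr sub0r normrN.
    have [->|jk] := eqVneq j k; first by rewrite ltnn addr0 mulr1 (le_lt_trans tk).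
    by rewrite mulr0 add0r; case: ifP; rewrite ?normr0.
  have lE : line (delta_mx 0 k : 'rV[R]_n) 1 = delta_mx 0 k by rewrite lineE scale1r.
  split; first by apply: derivable_affine_comp; rewrite lE; apply: fd.
  have -> : 'D_1 g t = 'D_(line (delta_mx 0 k) 1) f z.
    by have /(congr1 (@^~ t)) := derive_affine_comp (line (delta_mx 0 k)) (truncate h k + x) f 1.
  by rewrite lE; apply: dz.
have -> : f (h + x) - f x - D h =
    \sum_(k < n) (F k.+1 - F k - h 0 k * 'D_(delta_mx 0 k) f x).
  rewrite sumrB -(big_mkord xpredT (fun k => F k.+1 - F k)) telescope_sumr //.
  by rewrite /F truncate_all truncate0 add0r.
apply: le_trans (ler_norm_sum _ _ _) _.
apply: le_trans (ler_sum _ (fun k _ => stepE k)) _.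
rewrite sumr_const card_ord -mulr_natl mulrA ler_wpM2r // /e mulrCA ler_piMr ?(ltW eps0) //.
by rewrite ler_pdivrMr ?ltr0n // mul1r ler_nat.
Unshelve. all: by end_near. Qed.

End Partial.
End Differentiability.

(** * Total derivatives and lifts of maps to the torus *)

Section SmoothMaps.
Variable R : realType.

Lemma differentiable_row (V : normedModType R) (m : nat) (g : V -> 'rV[R]_m) (x : V) :
  (forall a, differentiable (fun z => g z 0 a : R) x) -> differentiable g x.
Proof.
move=> gd.
have -> : g = \sum_(a < m) (fun z => g z 0 a *: (delta_mx 0 a : 'rV[R]_m)).
  by apply/funext => z; rewrite fct_sumE -row_sum_delta.
by apply: differentiable_sum => a; apply: differentiableZl.
Qed.

Lemma smooth_differentiable (n m : nat) (U : set 'rV[R]_n) (g : 'rV[R]_n -> 'rV[R]_m)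
    (x : 'rV[R]_n) : open U -> smooth_on U g -> U x -> differentiable g x.
Proof.
move=> oU gs Ux; apply: differentiable_row => a.
have [_ gd] := gs 1%N.
have gda z v : U z -> derivable (fun z => g z 0 a) z v.
  by move=> Uz; have [/(_ z Uz)/derivable_mxP] := gd v.
apply: (differentiable_partial oU Ux) => [z i Uz|i]; first exact: gda.
have [gdv [gc _]] := gd (delta_mx 0 i).
have DE z : U z -> ('D_(delta_mx 0 i) g z) 0 a = 'D_(delta_mx 0 i) (fun z => g z 0 a) z.
  by move=> Uz; rewrite derive_mx ?mxE //; apply: gdv.
have ca : {for x, continuous (fun z => ('D_(delta_mx 0 i) g z) 0 a)}.
  exact: (cvg_comp _ _ (gc x Ux) (@coord_continuous _ _ _ 0 a _)).
apply: near_eq_continuous ca.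
have UU := open_nbhs_nbhs (conj oU Ux); by apply: filterS UU => z /DE ->.
Qed.

Lemma torus_projP (y z : 'rV[R]_4) : torus_proj y = torus_proj z <->
  exists k : 'I_4 -> int, forall a, y ord0 a - z ord0 a = 2 * pi * (k a)%:~R.
Proof.
split; first by move/eqmodP/asboolP.
by move=> H; apply/eqmodP/asboolP.
Qed.

Lemma torus_proj_inj_near (y z : 'rV[R]_4) : torus_proj y = torus_proj z ->
  (forall a, `|y ord0 a - z ord0 a| < 2 * pi) -> y = z.
Proof.
move=> /torus_projP[k kE] yz; apply/rowP => a; apply/subr0_eq.
have := yz a; rewrite kE normrM (ger0_norm (_ : 0 <= 2 * pi)); last first.
  by rewrite mulr_ge0 ?pi_ge0.
rewrite gtr_pMr ?mulr_gt0 ?pi_gt0 // -intr_norm ltrz1 => k1.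
have -> : k a = 0 by apply/eqP; rewrite -absz_eq0; move: k1; rewrite -abszE ltz_nat ltnS leqn0.
by rewrite mulr0.
Qed.

Lemma torus_projD (y z c : 'rV[R]_4) :
  torus_proj y = torus_proj z -> torus_proj (y + c) = torus_proj (z + c).
Proof.
move=> /torus_projP[k kE]; apply/torus_projP; exists k => a.
by rewrite !mxE -kE; ring.
Qed.

(* The fibres of the covering [R^4 -> T^4] are discrete, so two continuous lifts of the
   same map differ by a locally constant function. *)
Lemma lifts_near (T : topologicalType) (u v : T -> 'rV[R]_4) (t0 : T) :
  {for t0, continuous u} -> {for t0, continuous v} ->
  (\forall t \near t0, torus_proj (u t) = torus_proj (v t)) ->
  \forall t \near t0, u t = v t + (u t0 - v t0).
Proof.
move=> uc vc uv.
have uv0 := nbhs_singleton uv.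
have wc : (u t - v t - (u t0 - v t0)) @[t --> t0] --> (0 : 'rV[R]_4).
  rewrite -(subrr (u t0 - v t0)); apply: cvgB; last exact: cvg_cst.
  exact: cvgB.
have pi2 : 0 < 2 * pi :> R by rewrite mulr_gt0 ?pi_gt0.
have /cvgrPdist_lt /(_ _ pi2) w0 := wc.
near=> t.
(* Both differences lie in the lattice, so they are equal once they are closer than 2 pi. *)
have : torus_proj (u t - v t) = torus_proj (u t0 - v t0).
  have /(torus_projD (- v t)) -> : torus_proj (u t) = torus_proj (v t) by near: t.
  by rewrite subrr -(subrr (v t0)); apply/esym/torus_projD.
move/torus_proj_inj_near => H; rewrite -H ?subrKC // => a.
have : `|0 - (u t - v t - (u t0 - v t0))| < 2 * pi by near: t.
apply: le_lt_trans; rewrite sub0r normrN [leRHS]/Num.Def.normr /= mx_normrE.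
have := le_bigmax 0 (fun ij : 'I_1 * 'I_4 =>
  `|(u t - v t - (u t0 - v t0)) ij.1 ij.2|) (0, a).
by apply: le_trans; rewrite !mxE.
Unshelve. all: by end_near. Qed.

End SmoothMaps.

(** * The graph *)

Section Graph.
Variables (R : realType) (B : set 'rV[R]_3) (f : 'rV[R]_3 -> torus R).
Hypotheses (openB : open B) (smooth_f : torus_smooth_on B f).

Let S := torus_graph B f.

Lemma Ck_on_subset (V W : normedModType R) (k : nat) (U U' : set V) (g : V -> W) :
  U' `<=` U -> Ck_on k U g -> Ck_on k U' g.
Proof.
move=> UU'; elim: k g => [|k IH] g [gc gd].
  by split=> // x /UU'; apply: gc.
split=> [x /UU'|v]; first exact: gc.
by have [gdv gCk] := gd v; split=> [x /UU'|]; [apply: gdv|apply: IH].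
Qed.

Definition local_lift (x : 'rV[R]_3) (U : set 'rV[R]_3) (g : 'rV[R]_3 -> 'rV[R]_4) : Prop :=
  [/\ open U, U x, U `<=` B, smooth_on U g & forall z, U z -> torus_proj (g z) = f z].

Lemma exists_local_lift (x : 'rV[R]_3) : B x -> exists U g, local_lift x U g.
Proof.
move=> Bx; have [g [U [oU Ux gs gf]]] := smooth_f Bx.
exists (U `&` B), g; split => //; first exact: openI.
- by move=> k; apply: Ck_on_subset (gs k); apply: subIsetl.
- by move=> z [Uz _]; apply: gf.
Qed.

(** The lift inside [torus_partial] differs from [g] by a constant near [z], so their partial
    derivatives agree; differentiability of [g] extends this linearly to every direction. *)
Lemma derive_local_lift (x : 'rV[R]_3) (U : set 'rV[R]_3) (g : 'rV[R]_3 -> 'rV[R]_4)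
    (z v : 'rV[R]_3) : local_lift x U g -> U z -> 'D_v g z = v *m torus_jacobian f z.
Proof.
move=> [oU _ _ gs gf] Uz.
have gd : differentiable g z by apply: smooth_differentiable gs Uz.
have jacE i : 'D_(delta_mx 0 i) g z = row i (torus_jacobian f z).
  rewrite derive_mx; last exact: diff_derivable.
  apply/rowP => a; rewrite !mxE /torus_partial.
  set L := [set h | smooth_lift_at f z h].
  (* Since [g] is a lift at [z], [xget] returns a genuine lift and not its default value. *)
  have : L (xget (fun=> 0) L) by apply: (@xgetPex _ (fun=> 0) L); exists g, U.
  set g' := xget _ _ => -[U' [oU' U'z gs' gf']].
  have gc : {for z, continuous g} by apply: differentiable_continuous.
  have gc' : {for z, continuous g'}.
    by apply: differentiable_continuous; apply: smooth_differentiable gs' U'z.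
  have nearz : \forall y \near z, torus_proj (g' y) = torus_proj (g y).
    have UU' := open_nbhs_nbhs (conj (openI oU oU') (conj Uz U'z)).
    by apply: filterS UU' => y [Uy U'y]; rewrite gf // gf'.
  have gg' := lifts_near gc' gc nearz.
  have -> : 'D_(delta_mx 0 i) (fun y => g' y 0 a) z =
      'D_(delta_mx 0 i) ((fun y => g y 0 a) + cst ((g' z - g z) 0 a)) z.
    by apply: near_eq_derive; apply: filterS gg' => y ->; rewrite !mxE.
  have gda : derivable (fun y => g y 0 a) z (delta_mx 0 i).
    by have /derivable_mxP := @diff_derivable _ _ _ g z (delta_mx 0 i) gd; apply.
  by rewrite deriveD // derive_cst addr0.
rewrite deriveE // [in LHS](row_sum_delta v) linear_sum mulmx_sum_row.
by apply: eq_bigr => i _; rewrite linearZ -deriveE // jacE.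
Qed.

Lemma graph_ambientP (w : 'rV[R]_(3 + 4)) :
  S (ambient_proj w) <-> B (lsubmx w) /\ torus_proj (rsubmx w) = f (lsubmx w).
Proof.
split=> [[x Bx]|[Bw fw]]; first by case=> <- <-.
by exists (lsubmx w) => //; rewrite /ambient_proj fw.
Qed.

Lemma graphP (p : ambient R) : S p <-> B p.1 /\ p = (p.1, f p.1).
Proof. by split=> [[x Bx <-]|[Bp ->]] //; exists p.1. Qed.

Lemma tangent_graph (x : 'rV[R]_3) (v : 'rV[R]_(3 + 4)) : B x ->
  tangent S (x, f x) v <-> v = lsubmx v *m graph_frame (torus_jacobian f x).
Proof.
move=> Bx; have [U [g lift]] := exists_local_lift Bx.
have [oU Ux UB gs gf] := lift.
have gd : differentiable g x by apply: smooth_differentiable gs Ux.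
have frameE : (v = lsubmx v *m graph_frame (torus_jacobian f x)) <->
    rsubmx v = lsubmx v *m torus_jacobian f x.
  rewrite /graph_frame mul_mx_row mulmx1; split=> [->|vE].
    by rewrite row_mxKr row_mxKl.
  by rewrite -vE hsubmxK.
rewrite frameE; split.
  move=> [e [c [e0 cs cS c0 cv]]].
  have ec0 : `]- e, e[%classic (0 : R) by rewrite /= in_itv /= oppr_lt0 e0.
  have [cc cd] := cs 1%N.
  have [cdv _] := cd 1.
  have dc : differentiable c 0 by apply/derivable1_diffP; apply: cdv.
  have [lc0 rc0] : lsubmx (c 0) = x /\ torus_proj (rsubmx (c 0)) = f x.
    by case: c0.
  have dl : differentiable (lsubmx \o c) 0.
    by apply: differentiable_comp => //; apply: differentiable_lsubmx.
  have dr : differentiable (rsubmx \o c) 0.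
    by apply: differentiable_comp => //; apply: differentiable_rsubmx.
  have dgl : differentiable (g \o (lsubmx \o c)) 0.
    by apply: differentiable_comp => //=; rewrite lc0.
  (* Along a curve in the graph, its R^4 component and [g] of its base component lift the same curve
     in T^4, so they have the same velocity. *)
  have near0 : \forall t \near (0 : R), torus_proj ((rsubmx \o c) t) =
      torus_proj ((g \o (lsubmx \o c)) t).
    have nU : \forall t \near (0 : R), U (lsubmx (c t)).
      apply: (differentiable_continuous dl); rewrite /= lc0.
      exact: (open_nbhs_nbhs (conj oU Ux)).
    have ne : \forall t \near (0 : R), - e < t < e.
      have := @near_in_itvoo R (- e) e 0 ec0.
      by apply: filterS => t; rewrite in_itv.
    apply: filterS2 nU ne => t Ut te /=.
    by have /graph_ambientP[_ ->] := cS t te; rewrite gf.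
  have {}near0 := lifts_near (differentiable_continuous dr) (differentiable_continuous dgl) near0.
  have lE : 'D_1 (lsubmx \o c) 0 = lsubmx v.
    have [_ ->] := @derive_linear_comp _ _ _ _ (@lsubmx R 1 3 4) c 0 1
      (@continuous_lsubmx _ _ _ _) (diff_derivable dc).
    by rewrite cv.
  have rE : 'D_1 (rsubmx \o c) 0 = rsubmx v.
    have [_ ->] := @derive_linear_comp _ _ _ _ (@rsubmx R 1 3 4) c 0 1
      (@continuous_rsubmx _ _ _ _) (diff_derivable dc).
    by rewrite cv.
  rewrite -rE; have -> : 'D_1 (rsubmx \o c) 0 = 'D_1 (g \o (lsubmx \o c)) 0.
    transitivity ('D_1 ((g \o (lsubmx \o c)) +
      cst ((rsubmx \o c) 0 - (g \o (lsubmx \o c)) 0)) 0).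
      by apply: near_eq_derive; apply: filterS near0 => t ->.
    by rewrite deriveD ?derive_cst ?addr0 //; apply: diff_derivable.
  rewrite deriveE // diff_comp //= ?lc0 // -[lsubmx v]lE deriveE //.
  by rewrite -[RHS](derive_local_lift _ lift Ux) deriveE.
(* Conversely, [v] is the velocity of the curve lying over the straight line through [x] in
   direction [u]. *)
move=> vE; set u := lsubmx v in vE *.
have Uu : nbhs (0 : R) (fun t => U (line u t + x)).
  have : {for (0 : R), continuous (fun t => line u t + x)}.
    exact: (cvgD (@continuous_line _ _ u 0) (cvg_cst x)).
  by apply; rewrite /= scale0r add0r; exact: (open_nbhs_nbhs (conj oU Ux)).
have [e /= e0 eU] := (nbhs_ballP _ _).1 Uu.
have eU' t : - e < t < e -> U (line u t + x).
  by move=> te; apply: eU; rewrite /ball /= sub0r normrN ltr_norml.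
(* Writing the curve as an affine map plus [J] after [g] after an affine map brings it within the
   closure properties of [Ck_on]. *)
pose J : {linear 'rV[R]_4 -> 'rV[R]_(3 + 4)} := mulmxr (row_mx 0 1%:M).
have JE y : J y = row_mx 0 y by rewrite /J /= mul_mx_row mulmx0 mulmx1.
pose c t := line (row_mx u 0 : 'rV[R]_(3 + 4)) t + row_mx x 0 + J (g (line u t + x)).
have cE t : c t = row_mx (line u t + x) (g (line u t + x)).
  by rewrite /c JE lineE scale_row_mx !add_row_mx !scaler0 !addr0 add0r.
exists e, c; split => //.
- move=> k; apply: Ck_on_add; first exact: interval_open.
    exact: Ck_on_affine (@continuous_line _ _ _).
  apply: (@Ck_on_linear_comp _ _ _ _ _ _ J (fun t => g (line u t + x))).
  + exact: interval_open.
  + exact: mx_linear_continuous.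
  + apply: (Ck_on_affine_comp (@continuous_line _ _ u) _ (gs k)) => t /=.
    by rewrite in_itv /=; apply: eU'.
- move=> t te; apply/graph_ambientP; rewrite cE row_mxKl row_mxKr.
  by split; [apply/UB/eU'|apply/gf/eU'].
- by rewrite cE lineE scale0r add0r /ambient_proj row_mxKl row_mxKr gf.
have cU : derivable (fun t => g (line u t + x)) 0 1 /\
    'D_1 (fun t => g (line u t + x)) 0 = rsubmx v.
  split.
    apply: derivable_affine_comp; rewrite lineE scale0r add0r lineE scale1r.
    exact: diff_derivable.
  transitivity ('D_(line u 1) g (line u 0 + x)).
    by have /(congr1 (@^~ 0)) := derive_affine_comp (line u) x g 1.
  by rewrite !lineE scale0r add0r scale1r (derive_local_lift _ lift).
have [Jd JD] := @derive_linear_comp _ _ _ _ J _ _ _ (@mx_linear_continuous _ _ _ _ J) cU.1.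
have [Ad AD] : is_derive (0 : R) (1 : R)
    (fun t => line (row_mx u 0 : 'rV[R]_(3 + 4)) t + row_mx x 0) (line (row_mx u 0) 1).
  by apply: is_derive_affine; apply: continuous_line.
transitivity ('D_1 ((fun t => line (row_mx u 0 : 'rV[R]_(3 + 4)) t + row_mx x 0) +
    (J \o (fun t => g (line u t + x)))) 0); first by [].
rewrite deriveD // AD JD cU.2 JE lineE scale1r add_row_mx addr0 add0r /u.
exact: hsubmxK.
Qed.

End Graph.

(** * Slice charts of the graph *)

Section GraphSubmanifold.
Variables (R : realType) (B : set 'rV[R]_3) (f : 'rV[R]_3 -> torus R).
Hypotheses (openB : open B) (smooth_f : torus_smooth_on B f).

Let S := torus_graph B f.

(** The case [s = -1] flattens the graph of [g + d], and [s = 1] is its inverse because the base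
    component is preserved. *)
Definition shear (s : R) (d : 'rV[R]_4) (g : 'rV[R]_3 -> 'rV[R]_4)
    (w : 'rV[R]_(3 + 4)) : 'rV[R]_(3 + 4) :=
  row_mx (lsubmx w) (rsubmx w + s *: (g (lsubmx w) + d)).

Lemma smooth_shear (s : R) (d : 'rV[R]_4) (U : set 'rV[R]_3) (g : 'rV[R]_3 -> 'rV[R]_4)
    (W : set 'rV[R]_(3 + 4)) : open W -> (forall w, W w -> U (lsubmx w)) ->
  smooth_on U g -> smooth_on W (shear s d g).
Proof.
move=> oW WU gs k.
pose J : {linear 'rV[R]_4 -> 'rV[R]_(3 + 4)} := mulmxr (row_mx 0 s%:M).
have JE y : J y = row_mx 0 (s *: y).
  by rewrite /J /= mul_mx_row mulmx0 mul_mx_scalar.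
pose L : {linear 'rV[R]_(3 + 4) -> 'rV[R]_3} := @lsubmx R 1 3 4.
apply: (@Ck_on_ext _ _ _ _ _ (fun w => (idfun w + row_mx 0 (s *: d)) + J (g (L w + 0)))) => //.
  move=> w Ww; rewrite JE /= addr0 /shear -{1}[w]hsubmxK !add_row_mx !addr0.
  by rewrite scalerDr -addrA [s *: d + _]addrC.
apply: Ck_on_add => //.
  by apply: (@Ck_on_affine _ _ _ _ _ idfun) => w; apply: cvg_id.
apply: (@Ck_on_linear_comp _ _ _ _ _ _ J (fun w => g (L w + 0))) => //.
  exact: mx_linear_continuous.
apply: (@Ck_on_affine_comp _ _ _ _ _ _ U L 0) => //; first exact: continuous_lsubmx.
by move=> w /WU; rewrite addr0.
Qed.

Lemma submanifold_graph : submanifold3 S.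
Proof.
move=> z /graph_ambientP[Bx fx].
have [U [g lift]] := exists_local_lift openB smooth_f Bx.
have [oU Ux UB gs gf] := lift.
set x := lsubmx z in Bx fx Ux lift *.
(* The point [z] may lie on another sheet over the graph than that of [g]; translation by the
   lattice vector [d] moves the lift to the sheet through [z]. *)
pose d := rsubmx z - g x.
have gdf y : U y -> torus_proj (g y + d) = f y.
  move=> Uy; rewrite -gf //.
  have : torus_proj (rsubmx z) = torus_proj (g x) by rewrite fx gf.
  by move/(torus_projD (g y - g x)); rewrite /d [g x + _]subrKC addrCA.
(* Sheets over the same base point are at least 2 pi apart, so radius pi leaves a single sheet in
   the chart. *)
pose W' : set 'rV[R]_(3 + 4) := [set w | U (lsubmx w) /\ ball (0 : 'rV[R]_4) pi (rsubmx w)].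
pose W : set 'rV[R]_(3 + 4) := [set w | U (lsubmx w) /\
  ball (0 : 'rV[R]_4) pi (rsubmx w - (g (lsubmx w) + d))].
have openQ : open (ball (0 : 'rV[R]_4) pi) by apply: ball_open; apply: pi_gt0.
have oW' : open W'.
  apply: openI; apply: open_comp => // w _.
    exact: continuous_lsubmx.
  exact: continuous_rsubmx.
have oW : open W.
  rewrite openE => w [Uw Qw]; apply: filterI.
    by apply: (@continuous_lsubmx R 1 3 4 w U); exact: (open_nbhs_nbhs (conj oU Uw)).
  have gc : {for lsubmx w, continuous g}.
    by apply: differentiable_continuous; apply: smooth_differentiable gs Uw.
  have : (rsubmx y - (g (lsubmx y) + d)) @[y --> w] --> rsubmx w - (g (lsubmx w) + d).
    have gl : g (lsubmx y) @[y --> w] --> g (lsubmx w).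
      exact: (cvg_comp _ _ (@continuous_lsubmx R 1 3 4 w) gc).
    have rc : rsubmx y @[y --> w] --> rsubmx w by exact: (@continuous_rsubmx R 1 3 4 w).
    by apply: cvgB rc _; apply: cvgD gl _; apply: cvg_cst.
  by apply; exact: (open_nbhs_nbhs (conj openQ Qw)).
have rE w : rsubmx (shear (-1) d g w) = rsubmx w - (g (lsubmx w) + d).
  by rewrite row_mxKr scaleN1r.
have kE w : rsubmx (shear 1 d g w) = rsubmx w + (g (lsubmx w) + d).
  by rewrite row_mxKr scale1r.
have lE s w : lsubmx (shear s d g w) = lsubmx w by rewrite row_mxKl.
exists W, W', (shear (-1) d g), (shear 1 d g); split.
- split => //; split => //; rewrite -/x /d subrKC subrr.
  by apply: ballxx; apply: pi_gt0.
- by split; apply: smooth_shear gs => // w [].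
- move=> w [Uw Qw]; split; first by split; rewrite ?lE ?rE.
  by rewrite {1}/shear lE rE scale1r subrK hsubmxK.
- move=> w [Uw Qw]; split; first by split; rewrite ?lE ?kE ?addrK.
  by rewrite {1}/shear lE kE scaleN1r addrK hsubmxK.
- move=> w [Uw [_ Qw]]; rewrite rE; apply: (iff_trans (graph_ambientP B f w)); split.
    move=> [_ fw]; rewrite (@torus_proj_inj_near _ (rsubmx w) (g (lsubmx w) + d)) ?subrr //.
      by rewrite fw gdf.
    move=> a; have := Qw 0 a; rewrite /ball /= !mxE sub0r normrN => /lt_trans; apply.
    by rewrite ltr_pMl ?ltr1n ?pi_gt0.
  by move/subr0_eq => ->; split; [apply: UB|apply: gdf].
Qed.

End GraphSubmanifold.

(** * Gram determinants and tangent frames *)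

Section Frames.
Variable R : realType.
Implicit Types (A : 'M[R]_(3, 4)) (V : 'M[R]_(3, 3 + 4)).

(** The sum of squares gives nonnegativity. A row vector v killed by 1 + A A^T satisfies |v|^2 + |v
    A|^2 = 0, so the determinant is nonzero. *)
Lemma det_gram_gt0 A : 0 < \det (graph_frame A *m (graph_frame A)^T).
Proof.
rewrite lt0r; apply/andP; split; last first.
  rewrite det_gram_graph_frame !addr_ge0 ?sqr_ge0 //; apply: sumr_ge0 => i _; exact: sqr_ge0.
rewrite gram_graph_frame; apply/det0P => -[v v0].
rewrite mulmxDr mulmx1 mulmxA => /(congr1 (fun w => (w *m v^T) 0 0)).
rewrite mulmxDl mul0mx -mulmxA -trmx_mul !mxE => /eqP.
have sq n (w : 'rV[R]_n) : \sum_j w 0 j * w^T j 0 = \sum_j w 0 j ^+ 2.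
  by apply: eq_bigr => j _; rewrite mxE expr2.
have sq0 n (w : 'rV[R]_n) : 0 <= \sum_j w 0 j ^+ 2.
  by apply: sumr_ge0 => j _; apply: sqr_ge0.
rewrite !sq paddr_eq0 // => /andP[+ _]; rewrite psumr_eq0 => [/allP H|j _]; last exact: sqr_ge0.
case/eqP: v0; apply/rowP => j; have := H j (mem_index_enum j).
by rewrite mxE sqrf_eq0 => /eqP.
Qed.

Lemma phi_sqr A : (forall k : 'I_4, chi A k = 0) ->
  \det (graph_frame A *m (graph_frame A)^T) = ext_eval (g2_phi R) (graph_frame A) ^+ 2.
Proof.
move=> chi0; rewrite det_gram_graph_frame big1 => [|k _]; last by rewrite chi0 expr0n.
rewrite addr0 big1 ?addr0 // => i _; rewrite big1 ?expr0n // => k _.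
by rewrite chi0 mulr0.
Qed.

Lemma chi_eq0 A :
  \det (graph_frame A *m (graph_frame A)^T) = ext_eval (g2_phi R) (graph_frame A) ^+ 2 ->
  forall k : 'I_4, chi A k = 0.
Proof.
rewrite det_gram_graph_frame -addrA => /eqP; rewrite addrC -subr_eq0 addrK.
rewrite paddr_eq0; try by apply: sumr_ge0 => i _; apply: sqr_ge0.
move=> /andP[+ _]; rewrite psumr_eq0 => [/allP H k|k _]; last exact: sqr_ge0.
by have := H k (mem_index_enum k); rewrite sqrf_eq0 => /eqP.
Qed.

Lemma graph_frame_eq A V : (forall i, row i V = lsubmx (row i V) *m graph_frame A) <->
  V = lsubmx V *m graph_frame A.
Proof.
have lrow i : lsubmx (row i V) = row i (lsubmx V) by apply/matrixP => a b; rewrite !mxE.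
split=> [H|VE i]; first by apply/row_matrixP => i; rewrite H row_mul lrow.
by rewrite {1}VE row_mul lrow.
Qed.

Lemma det_lsubmx_frame A V : V = lsubmx V *m graph_frame A ->
  row_free V -> \det (lsubmx V) != 0.
Proof.
move=> VE; rewrite -unitfE -unitmxE -row_free_unit -!row_leq_rank => Vfree.
by apply: leq_trans Vfree _; rewrite {1}VE mxrankM_maxl.
Qed.

End Frames.

(** * The calibration condition and the orientation *)

Section GraphAssociative.
Variables (R : realType) (B : set 'rV[R]_3) (f : 'rV[R]_3 -> torus R).
Hypotheses (openB : open B) (smooth_f : torus_smooth_on B f).

Let S := torus_graph B f.
Let M x := graph_frame (torus_jacobian f x).
Let phiM x := ext_eval (g2_phi R) (M x).

Lemma continuous_graph_frame (x : 'rV[R]_3) i j : B x ->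
  {for x, continuous (fun z => M z i j)}.
Proof.
move=> Bx; have [U [g lift]] := exists_local_lift openB smooth_f Bx.
have [oU Ux _ gs _] := lift.
have [_ gd] := gs 1%N; have [_ [gc _]] := gd (delta_mx 0 i).
rewrite /M /graph_frame.
have [a ja|a ja] := splitP j.
  have -> : (fun z => row_mx 1%:M (torus_jacobian f z) i j) = fun=> 1%:M i a.
    by apply/funext => z; rewrite (_ : j = lshift 4 a) ?row_mxEl //; apply: val_inj.
  by apply: cst_continuous.
have -> : (fun z => row_mx 1%:M (torus_jacobian f z) i j) =
    fun z => torus_jacobian f z i a.
  by apply/funext => z; rewrite (_ : j = rshift 3 a) ?row_mxEr //; apply: val_inj.
have ca : {for x, continuous (fun z => ('D_(delta_mx 0 i) g z) 0 a)}.
  exact: (cvg_comp _ _ (gc x Ux) (@coord_continuous _ _ _ 0 a _)).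
apply: near_eq_continuous ca; have nU := open_nbhs_nbhs (conj oU Ux).
apply: filterS nU => z Uz.
by rewrite (derive_local_lift _ lift Uz) -rowE mxE.
Qed.

Lemma tangent_frame_graph (p : ambient R) (V : 'M[R]_(3, 3 + 4)) : S p ->
  (forall i, tangent S p (row i V)) <-> V = lsubmx V *m M p.1.
Proof.
move=> /graphP[Bp pE]; rewrite -graph_frame_eq.
by split=> H i; have := H i; rewrite pE tangent_graph.
Qed.

(** Squaring the calibration equation on the graph frame removes the sign that depends on [o]. *)
Lemma associative_chi (o : ambient R -> 'M[R]_(3, 3 + 4) -> bool) (x : 'rV[R]_3) :
  associative_submanifold B S o -> B x -> forall k : 'I_4, chi (torus_jacobian f x) k = 0.
Proof.
move=> [_ _ _ calib] Bx; apply: chi_eq0.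
have Sp : S (x, f x) by exists x.
have tang : forall i, tangent S (x, f x) (row i (M x)).
  by apply/(tangent_frame_graph _ Sp); rewrite /M /graph_frame row_mxKl mul1mx.
rewrite (calib _ _ Sp tang) /induced_volume exprMn sqr_sqrtr ?(ltW (det_gram_gt0 _)) //.
by case: ifP => _; rewrite ?sqrrN expr1n mul1r.
Qed.

Lemma chi_associative : (forall x, B x -> forall k : 'I_4, chi (torus_jacobian f x) k = 0) ->
  associative_submanifold B S (fun _ V => 0 < ext_eval (g2_phi R) V).
Proof.
move=> chi0.
have phiM0 x : B x -> phiM x != 0.
  by move=> Bx; rewrite -sqrf_eq0 -phi_sqr ?(gt_eqF (det_gram_gt0 _)) //; apply: chi0.
split.
- by move=> p /graphP[].
- exact: submanifold_graph.
- split=> [p V A Sp [/(tangent_frame_graph _ Sp) VE Vfree] Aunit|z /graph_ambientP[Bx fx]].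
    have phiV0 : ext_eval (g2_phi R) V != 0.
      have [Bp _] := (graphP _ _ _).1 Sp.
      by rewrite VE ext_eval_mulmx mulf_neq0 ?phiM0 // (det_lsubmx_frame VE).
    rewrite ext_eval_mulmx; move: Aunit; rewrite unitmxE unitfE => detA0.
    have [phiV|phiV|phiV] := ltgtP 0 (ext_eval (g2_phi R) V).
    + by rewrite pmulr_lgt0.
    + by rewrite nmulr_lgt0 // eq_sym eqbF_neg -leNgt le_eqVlt (negbTE detA0).
    + by rewrite -phiV eqxx in phiV0.
  (* The graph frame may be negative at [z]. Scaling its three rows by the sign [s] multiplies phi
     by [s^3 = s], and on [W] the result stays positive. *)
  pose s := Num.sg (phiM (lsubmx z)).
  pose W : set 'rV[R]_(3 + 4) :=
    [set w : 'rV[R]_(3 + 4) | B (lsubmx w) /\ 0 < s * phiM (lsubmx w)].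
  have contM (w : 'rV[R]_(3 + 4)) i j : B (lsubmx w) ->
      {for w, continuous (fun y : 'rV[R]_(3 + 4) => (s *: M (lsubmx y)) i j)}.
    move=> Bw.
    have -> : (fun y : 'rV[R]_(3 + 4) => (s *: M (lsubmx y)) i j) =
        fun y => s * M (lsubmx y) i j.
      by apply/funext => y; rewrite mxE.
    have Mc : M (lsubmx y) i j @[y --> w] --> M (lsubmx w) i j.
      exact: (cvg_comp _ _ (@continuous_lsubmx R 1 3 4 w) (@continuous_graph_frame _ i j Bw)).
    exact: (cvgM (cvg_cst s) Mc).
  have oW : open W.
    rewrite openE => w [Bw sw]; apply: filterI.
      by apply: (@continuous_lsubmx R 1 3 4 w B); exact: (open_nbhs_nbhs (conj openB Bw)).
    have phic : {for lsubmx w, continuous phiM}.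
      by apply: ext_eval_continuous => i j; apply: continuous_graph_frame.
    have lc : phiM (lsubmx y) @[y --> w] --> phiM (lsubmx w).
      exact: (cvg_comp _ _ (@continuous_lsubmx R 1 3 4 w) phic).
    have : s * phiM (lsubmx y) @[y --> w] --> s * phiM (lsubmx w).
      exact: (cvgM (cvg_cst s) lc).
    by move/(_ [set t | 0 < t]); apply; apply: lt_nbhsr.
  have s2 : s * s = 1.
    by rewrite -expr2 /s sqr_sg phiM0.
  exists W, (fun w => s *: M (lsubmx w)); split => //.
  + by split=> //; rewrite /s -normrEsg normr_gt0 phiM0.
  + apply: (@continuous_subspaceW _ _ _ W); first exact: subIsetl.
    apply: continuous_in_subspaceT => w /set_mem[Bw _].
    by apply: mx_continuous => i j; apply: contM.
  + move=> w [Bw sw] Sw; split; last first.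
      rewrite -mul_scalar_mx ext_eval_mulmx det_scalar exprS expr2 s2 mulr1 //.
    split.
      apply/(tangent_frame_graph _ Sw).
      by rewrite -mul_scalar_mx /M /graph_frame mul_mx_row mulmx1 row_mxKl mul_mx_row mulmx1.
    (* A right inverse: the base block of the frame is [s] times the identity, and [s * s = 1]. *)
    apply/row_freeP; exists (s *: col_mx 1%:M 0).
    rewrite -scalemxAl -scalemxAr scalerA s2 scale1r.
    by rewrite /M /graph_frame mul_row_col mulmx1 mulmx0 addr0.
- move=> p V Sp /(tangent_frame_graph _ Sp) VE; have [Bp _] := (graphP _ _ _).1 Sp.
  have detE : \det (V *m V^T) = ext_eval (g2_phi R) V ^+ 2.
    rewrite VE ext_eval_mulmx trmx_mul mulmxA -(mulmxA (lsubmx V)) !det_mulmx det_tr.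
    by rewrite phi_sqr ?exprMn; [ring | apply: chi0].
  rewrite /induced_volume detE sqrtr_sqr.
  (* The nonpositive case includes dependent vectors, on which phi and the volume both vanish. *)
  case: ltP => phiV; first by rewrite mul1r gtr0_norm.
  by rewrite mulN1r ler0_norm // opprK.
Qed.

End GraphAssociative.

Theorem proposition4p1 (R : realType) (B : set 'rV[R]_3)
    (f : 'rV[R]_3 -> torus R) (openB : open B) (smooth_f : torus_smooth_on B f) :
  let S : set (ambient R) := torus_graph B f in
  let F : ambient R -> ext R[i] := curvature f in
  let phi : ext R[i] := g2_phi R[i] in
  let is_assoc := exists o, associative_submanifold B S o in
  let cubic_eq := forall p : ambient R, B p.1 ->
    6^-1 *: wedge_exp (F p) 3 + wedge (F p) (hodge phi) = 0 in
  let square_eq := forall p : ambient R, B p.1 ->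
    wedge phi (hodge (wedge_exp (F p) 2)) = 0 in
  (is_assoc <-> cubic_eq) /\ (cubic_eq <-> (cubic_eq /\ square_eq)).
Proof.
move=> S F phi is_assoc cubic_eq square_eq; split; split.
- by move=> [pos assoc] p Bp; apply/cubic_eqP; apply: (associative_chi openB smooth_f assoc).
- move=> cubic; exists (fun _ V => 0 < ext_eval (g2_phi R) V).
  apply: chi_associative => // x Bx.
  (* The curvature depends only on the base point, so any point of the fibre over [x] would
     serve. *)
  by apply/(cubic_eqP f (x, f x)); apply: cubic.
- move=> cubic; split=> // p Bp; apply: chi_square_eq.
  by apply/cubic_eqP; apply: cubic.
- by case.
Qed.
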